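(* For each $n$, let $A_n$ be the $n\times n$ reverse circulant matrix $RC_n$, or for each $n$ let $A_n$ be the $n\times n$ Hankel matrix $H_n$, built from a Gaussian input sequence $\{X_j : j\ge 0\}$. Suppose $\{p_n\}$ is a sequence of positive even integers such that $p_n=o(\log n/\log\log n)$. Then, as $n\to\infty$, $$\frac{\mathrm{Tr}(A_n^{p_n})-\mathbf{E}[\mathrm{Tr}(A_n^{p_n})]}{\sqrt{\mathrm{Var}(\mathrm{Tr}(A_n^{p_n}))}}$$ converges in total variation norm to $N(0,1)$.
   Context: A Gaussian input sequence $\{X_j: j\ge 0\}$ is a sequence of i.i.d. standard normal random variables. For $1\le i,j\le n$, the reverse circulant matrix $RC_n$ has $(i,j)$-th entry $X_{(i+j-1)\bmod n}$, with residues taken in $\{1,\dots,n\}$. The Hankel matrix $H_n$ has $(i,j)$-th entry $X_{i+j-1}$. Convergence in total variation norm means that the total variation distance between the laws tends to $0$. *)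

(* Defs.v *)
From HB Require Import structures.
From mathcomp Require Import all_boot all_order all_algebra.
From mathcomp Require Import finmap.
From mathcomp Require Import all_classical all_reals all_analysis.
From mathcomp Require Import measurable_realfun.

Set Implicit Arguments.
Unset Strict Implicit.
Unset Printing Implicit Defensive.

Import Order.TTheory GRing.Theory Num.Theory.
Import numFieldNormedType.Exports.

Local Open Scope classical_set_scope.
Local Open Scope ring_scope.

Definition independent_RVs d (T : measurableType d) (R : realType)
    (P : probability T R) (I : choiceType) (X : I -> {RV P >-> R}) : Prop :=
  forall (J : {fset I}) (B : I -> set R),
    (forall i, measurable (B i)) ->
    P (\bigcap_(i in [set` J]) X i @^-1` B i) =
    (\prod_(i <- J) P (X i @^-1` B i))%E.

Arguments independent_RVs [d T R] P [I] X.

Definition gaussian_input d (T : measurableType d) (R : realType)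
    (P : probability T R) (X : nat -> {RV P >-> R}) : Prop :=
  independent_RVs P X /\
  forall j (B : set R), measurable B ->
    distribution P (X j) B = normal_prob 0 1 B.

Arguments gaussian_input [d T R] P X.

(* Link functions give the index of the input variable in position (i, j),
   for row and column numbers i, j running from 1 to n. *)

(* The residue of k modulo n, taken in {1, ..., n}. *)
Definition residue1 (k n : nat) : nat := if (n %| k)%N then n else (k %% n)%N.

Definition rc_link (n i j : nat) : nat := residue1 (i + j - 1)%N n.

Definition hankel_link (n i j : nat) : nat := (i + j - 1)%N.

(* The ordinals of 'I_n start at 0, hence the shift by one. *)
Definition patterned_matrix (T : Type) (R : realType)
    (L : nat -> nat -> nat -> nat) (X : nat -> T -> R) (n : nat) (w : T) :
    'M[R]_n :=
  \matrix_(i < n, j < n) X (L n i.+1 j.+1) w.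

Definition trace_power d (T : measurableType d) (R : realType)
    (L : nat -> nat -> nat -> nat)
    (X : nat -> {mfun T >-> R}) (n p : nat) (w : T) : R :=
  \tr (patterned_matrix L X n w ^+ p).

Lemma measurable_trace_power d (T : measurableType d) (R : realType)
    (L : nat -> nat -> nat -> nat)
    (X : nat -> {mfun T >-> R}) (n p : nat) :
  measurable_fun setT (trace_power L X n p).
Proof.
have H q : forall i j,
    measurable_fun setT (fun w => (patterned_matrix L X n w ^+ q) i j).
  elim: q => [|q IH] i j.
    by under eq_fun do rewrite expr0 mxE; exact: measurable_cst.
  under eq_fun do rewrite exprS mxE.
  apply: measurable_sum => k; apply: measurable_funM; last exact: IH.
  by under eq_fun do rewrite mxE; exact: measurable_funPT.
by apply: measurable_sum => i; exact: H.
Qed.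

HB.instance Definition _ d (T : measurableType d) (R : realType)
    (L : nat -> nat -> nat -> nat)
    (X : nat -> {mfun T >-> R}) (n p : nat) :=
  isMeasurableFun.Build _ _ _ _ (trace_power L X n p)
    (measurable_trace_power L X n p).

Definition standardized d (T : measurableType d) (R : realType)
    (P : probability T R) (Y : {RV P >-> R}) (w : T) : R :=
  (Y w - fine 'E_P[Y]) / Num.sqrt (fine 'V_P[Y]).

Arguments standardized [d T R] P Y w.

Lemma measurable_standardized d (T : measurableType d) (R : realType)
    (P : probability T R) (Y : {RV P >-> R}) :
  measurable_fun setT (standardized P Y).
Proof.
by apply: measurable_funM => //; apply: measurable_funB => //.
Qed.

HB.instance Definition _ d (T : measurableType d) (R : realType)
    (P : probability T R) (Y : {RV P >-> R}) :=
  isMeasurableFun.Build _ _ _ _ (standardized P Y)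
    (measurable_standardized Y).

(* The arguments are bare set functions because [normal_prob] and [distribution]
   are probabilities for two distinct displays of the same Borel sigma-algebra. *)
Definition tv_dist (R : realType) (mu nu : set R -> \bar R) : \bar R :=
  ereal_sup [set `|mu B - nu B|%E | B in measurable].

(* Main.v *)
(* The trace g = Tr A^p is a sum of words (monomials) in the Gaussian inputs.
   Gaussian integration by parts, applied to the first letter of a word and
   iterated, writes w - E w as the divergence of an explicit vector field u_w
   with monomial coefficients. With Gamma = sum_w <u_w, grad g> this gives
   E[(g - E g) phi(g)] = E[Gamma phi'(g)], hence E Gamma = Var g, and Stein's
   method bounds the total variation distance to N(0,1) by a multiple of
   (Var Gamma)^(1/2) / Var g.

   Var Gamma is at most p^O(p) times the number of quadruples of closed walks
   of length p on {1..n} whose letters all pair up and whose pairings connect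
   the four walks. A walk is determined by its starting point and all but one
   of its letters, so such a quadruple is determined by 4 starting points and
   4p - 6 letters that pair up among themselves; there are at most
   p^O(p) n^(2p+1) of them. On the other hand Cauchy-Schwarz against
   sum_j X_j^2 yields Var g >= c (p E g)^2 / n, where E g >= n^(p/2+1), so that
   Var g >= c n^(p+1). Hence Var Gamma / (Var g)^2 <= p^O(p) / n, which tends
   to 0 when p = o(log n / log log n). *)

From HB Require Import structures.
Require Import Defs.
From mathcomp Require Import all_boot all_order all_algebra finmap.
From mathcomp Require Import all_classical all_reals all_analysis.
From mathcomp Require Import measurable_realfun.
From mathcomp Require Import ring lra zify.

Set Implicit Arguments.
Unset Strict Implicit.
Unset Printing Implicit Defensive.

Import Order.TTheory GRing.Theory Num.Theory.
Import numFieldNormedType.Exports.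

Local Open Scope ring_scope.

(** The field u_w plays the part of the inverse Ornstein-Uhlenbeck operator, but its coefficients
    are words, so that Gamma is again a sum of words and its variance becomes a count. Means of
    words factor when the letters are disjoint, hence only pairs of words of Gamma with a common
    letter contribute to Var Gamma. This explains 4p - 6. Among the 4p letters, the contraction
    inside each factor of Gamma^2 equates two, and the common letter equates one of each factor: six
    positions drop out in equal pairs. They can be recovered because, in each factor, one of the two
    walks lacks a single letter; once closed up it yields the contracted letter of its partner,
    which then lacks a single letter as well. The remaining letters pair up, so they take at most 2p
    - 3 values, and with 4 starting points this gives n^(2p+1). Total variation is reached because
    the Stein solution of a merely continuous test function with values in [0, 1] already has
    derivative bounded by 2, with no smoothness entering the constant. *)

Lemma big_flatten_seq (R : Type) (idx : R) (op : Monoid.law idx) (I : Type)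
  (ss : seq (seq I)) (F : I -> R) :
  \big[op/idx]_(i <- flatten ss) F i =
  \big[op/idx]_(s <- ss) \big[op/idx]_(i <- s) F i.
Proof.
elim: ss => [|s ss IH] /=; first by rewrite !big_nil.
by rewrite big_cat big_cons IH.
Qed.

Lemma big_nseq_const (V : nmodType) (I : Type) n (i : I) (F : I -> V) :
  \sum_(k <- nseq n i) F k = F i *+ n.
Proof. by rewrite big_nseq iter_addr_0. Qed.

(** * Words, pairings and closed walks *)

Section Combinatorics.
Local Open Scope nat_scope.

(* Wick's recursion for the mean of a word in standard Gaussians; a word of size
   at most n receives its actual value, independent of the fuel n. *)
Fixpoint wick_fuel (n : nat) (w : seq nat) : nat :=
  if n is n'.+1 then
    if w is a :: w' then (count_mem a w' * wick_fuel n' (rem a w'))%N else 1%N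
  else 1%N.

Definition wick (w : seq nat) : nat := wick_fuel (size w) w.

(* A pair (a, v) stands for the field v e_a, where v is a monomial: the word a w'
   equals the divergence of w' e_a plus the partial derivative of w' along a. *)
Fixpoint stein_fuel (n : nat) (w : seq nat) : seq (nat * seq nat) :=
  if n is n'.+1 then
    if w is a :: w' then
      (a, w') :: flatten (nseq (count_mem a w') (stein_fuel n' (rem a w')))
    else [::]
  else [::].

Definition stein_field (w : seq nat) : seq (nat * seq nat) := stein_fuel (size w) w.

(* The words of sum_w <u_w, grad g>, where g is the sum of the words of gs. *)
Definition stein_kernel (gs : seq (seq nat)) : seq (seq nat) :=
  flatten [seq flatten [seq flatten [seq
    nseq (count_mem jv.1 w2) (jv.2 ++ rem jv.1 w2)
  | w2 <- gs] | jv <- stein_field w1] | w1 <- gs].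

Section WickCombinatorics.
Implicit Types (w v t : seq nat) (gs : seq (seq nat)).

Lemma size_rem_lt a w : size (rem a w) <= size w.
Proof. by case: (boolP (a \in w)) => aw; [rewrite size_rem// leq_pred|rewrite rem_id]. Qed.

Lemma wick_fuelE n w : size w <= n -> wick_fuel n w = wick w.
Proof.
rewrite /wick; elim/ltn_ind: n w => n IH [|a w]; first by case: n {IH}.
case: n IH => [//|n] IH /=; rewrite ltnS => wn.
have [aw|aw] := boolP (a \in w); last by rewrite (count_memPn aw).
have s1 : size (rem a w) <= size w by exact: size_rem_lt.
rewrite IH//; last exact: leq_trans wn.
by rewrite [in RHS](IH (size w)).
Qed.

Lemma wick_cons a w : wick (a :: w) = count_mem a w * wick (rem a w).
Proof. by rewrite {1}/wick /= wick_fuelE// size_rem_lt. Qed.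

Lemma wick_le_fact w : wick w <= (size w)`!.
Proof.
have [n] := ubnP (size w); elim: n w => // n IH [|a w] //= wn.
rewrite wick_cons.
have [aw|aw] := boolP (a \in w); last by rewrite (count_memPn aw).
apply: (@leq_trans (size w * (size w).-1`!)).
  apply: leq_mul; first exact: count_size.
  by rewrite -(size_rem aw); apply: IH; rewrite size_rem//; exact: leq_ltn_trans (leq_pred _) (wn : size w < n).
case: (size w) => [//|m] /=; rewrite -factS.
by apply: leq_fact.
Qed.

Definition even_word w := forall a, ~~ odd (count_mem a w).

Lemma even_word_perm w v : perm_eq w v -> even_word w -> even_word v.
Proof. by move=> /permP h ew a; rewrite -h. Qed.

Lemma even_word_cons2 a w : even_word [:: a, a & w] <-> even_word w.
Proof.
split=> h b; have := h b; rewrite /= addnA oddD.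
  by case: (a == b).
by case: (a == b) => //=; rewrite negbK.
Qed.

Lemma wick_gt0P w : 0 < wick w <-> even_word w.
Proof.
have [n] := ubnP (size w); elim: n w => // n IH [|a w] /= wn; first by split=> // _ a.
rewrite wick_cons muln_gt0 -has_count has_pred1.
have [aw|aw] := boolP (a \in w) => /=.
  rewrite IH; last by rewrite size_rem//; exact: leq_ltn_trans (leq_pred _) (wn : size w < n).
  have h : perm_eq (a :: w) [:: a, a & rem a w] by rewrite perm_cons perm_to_rem.
  rewrite -(even_word_cons2 a).
  by split; apply: even_word_perm; rewrite // perm_sym.
by split=> // /(_ a); rewrite /= eqxx (count_memPn aw).
Qed.

Lemma rem_catl a w v : a \in w -> rem a (w ++ v) = rem a w ++ v.
Proof.
elim: w => //= b w IH; rewrite inE eq_sym; case: eqVneq => //= _ aw.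
by rewrite IH.
Qed.

(** No pairing of equal letters can join the two words: this is independence at the level of Wick's
    recursion. It removes from Var Gamma all pairs of kernel words without a common letter. *)
Lemma wick_cat_disjoint w v : ~~ has (mem w) v -> wick (w ++ v) = wick w * wick v.
Proof.
have [n] := ubnP (size w); elim: n w => // n IH [|a w] wn.
  by rewrite /= mul1n.
rewrite cat_cons !wick_cons -mulnA.
move=> h; have av : a \notin v.
  by apply: contra h => av; apply/hasP; exists a => //; rewrite !inE eqxx.
rewrite count_cat (count_memPn av) addn0.
have [aw|aw] := boolP (a \in w); last by rewrite (count_memPn aw).
rewrite rem_catl// IH//.
  by rewrite size_rem//; exact: leq_ltn_trans (leq_pred _) (wn : size w < n).
apply: contra h => /hasP[x xv xw]; apply/hasP; exists x => //.
by rewrite /= !inE (mem_rem xw) orbT.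
Qed.

(** The recursion either stops at the first letter or discards it together with an equal partner;
    [q] keeps one letter of each discarded pair. *)
Lemma stein_fieldP w jv : jv \in stein_field w ->
  exists q, perm_eq w (jv.1 :: jv.2 ++ q ++ q).
Proof.
rewrite /stein_field; move: (size w) => n; elim: n w => [|n IH] [|a w] //=.
rewrite inE => /predU1P[->|].
  by exists [::]; rewrite /= cats0.
case/flattenP => s /nseqP[-> ca] /IH[q hq]; exists (a :: q).
have aw : a \in w by rewrite -has_pred1 has_count.
apply: perm_trans (_ : perm_eq _ [:: a, a & rem a w]) _.
  by rewrite perm_cons perm_to_rem.
apply: (@perm_trans _ [:: a, a & (jv.1 :: jv.2 ++ q ++ q)]).
  by rewrite !perm_cons.
apply/permP => P /=; rewrite !count_cat /= !count_cat /=; lia.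
Qed.

Lemma size_flatten_nseq (T : Type) n (s : seq T) : size (flatten (nseq n s)) = n * size s.
Proof. by elim: n => //= n IH; rewrite size_cat IH mulSn. Qed.

Lemma size_stein_field w : size (stein_field w) <= (size w)`!.
Proof.
rewrite /stein_field; suff : forall n, size w <= n -> size (stein_fuel n w) <= (size w)`!.
  by apply.
move=> n; elim: n w => [|n IH] [|a w] //=; rewrite ltnS => wn.
rewrite size_flatten_nseq.
have [aw|aw] := boolP (a \in w); last by rewrite (count_memPn aw) fact_gt0.
have h := IH (rem a w) (leq_trans (size_rem_lt _ _) wn).
rewrite size_rem// in h.
have w0 : 0 < size w by case: (w) aw.
(* The extra 1 is the entry [(a, w)]; the other entries come from at most [size w] partners of [a],
   each giving at most [(size w).-1] factorial. *)
apply: (@leq_trans (size w)`!.+1).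
  rewrite ltnS; apply: leq_trans (leq_mul (count_size _ _) h) _.
  by rewrite -{1}(prednK w0) -factS prednK.
rewrite factS mulSn -addn1 leq_add2l muln_gt0 w0; exact: fact_gt0.
Qed.

(** The bilinear piece <u_w1, grad w2> of [stein_kernel], isolated so that sums over the kernel
    become sums over pairs of walks. *)
Definition pair_kernel w1 w2 : seq (seq nat) :=
  flatten [seq nseq (count_mem jv.1 w2) (jv.2 ++ rem jv.1 w2) | jv <- stein_field w1].

Lemma size_pair_kernel w1 w2 : size (pair_kernel w1 w2) <= (size w1)`! * size w2.
Proof.
apply: leq_trans (leq_mul (size_stein_field w1) (leqnn _)).
rewrite /pair_kernel; elim: (stein_field w1) => //= jv s IH.
by rewrite size_cat size_nseq mulSn leq_add// count_size.
Qed.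

Lemma pair_kernelP w1 w2 t : t \in pair_kernel w1 w2 ->
  exists j v q, [/\ perm_eq w1 (j :: v ++ q ++ q), j \in w2 & t = v ++ rem j w2].
Proof.
case/flatten_mapP => jv /stein_fieldP[q hq] /nseqP[-> c0].
by exists jv.1, jv.2, q; split => //; rewrite -has_pred1 has_count.
Qed.

Lemma size_pair_kernel_word w1 w2 t : t \in pair_kernel w1 w2 ->
  size t <= size w1 + size w2.
Proof.
case/pair_kernelP => j [v [q [/perm_size h jw ->]]].
rewrite size_cat size_rem//; move: h; rewrite /= !size_cat; lia.
Qed.

Lemma stein_kernel_sum (V : nmodType) gs (F : seq nat -> V) :
  (\sum_(t <- stein_kernel gs) F t =
  \sum_(w1 <- gs) \sum_(w2 <- gs) \sum_(t <- pair_kernel w1 w2) F t)%R.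
Proof.
rewrite /stein_kernel big_flatten_seq big_map; apply: eq_bigr => w1 _.
rewrite big_flatten_seq big_map.
under eq_bigr do rewrite big_flatten_seq big_map.
rewrite exchange_big; apply: eq_bigr => w2 _ /=.
by rewrite /pair_kernel big_flatten_seq big_map.
Qed.

End WickCombinatorics.

Lemma even_word_half w : even_word w -> exists q, perm_eq w (q ++ q).
Proof.
have [n] := ubnP (size w); elim: n w => // n IH [|a w] wn ew; first by exists [::].
have aw : a \in w.
  apply: contraT => aw; have := ew a.
  by rewrite /= eqxx (count_memPn aw).
have h : perm_eq (a :: w) [:: a, a & rem a w] by rewrite perm_cons perm_to_rem.
have [||q hq] := IH (rem a w).
- by rewrite size_rem//; exact: leq_ltn_trans (leq_pred _) (wn : size w < n).
- by rewrite -(even_word_cons2 a); exact: even_word_perm h ew.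
exists (a :: q); apply: perm_trans h _.
apply: (@perm_trans _ [:: a, a & q ++ q]); first by rewrite !perm_cons.
by apply/permP => P /=; rewrite !count_cat /=; lia.
Qed.

(** * Counting linked quadruples of closed walks *)

Section Paths.
Variables (n p B : nat) (lam : 'I_n -> 'I_n -> nat).
Hypothesis lamC : forall a b, lam a b = lam b a.
Hypothesis lamI : forall a, injective (lam a).
Hypothesis lamB : forall a b, lam a b < B.

Notation ord_p := 'I_p.+2.
Notation path := {ffun ord_p -> 'I_n}.
Implicit Types (i : path) (k : ord_p).

(** [lam] stands for either link function; both matrices enter only through its symmetry, its
    injectivity in one argument and the bound [B]. Walks have length [p.+2] and are cyclic, [ordS]
    sending the last position to the first. *)
Definition letter i k := lam (i k) (i (ordS k)).

Definition path_word i : seq nat := [seq letter i k | k <- enum ord_p].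

Lemma size_path_word i : size (path_word i) = p.+2.
Proof. by rewrite size_map size_enum_ord. Qed.

Lemma count_path_word i c : count_mem c (path_word i) = \sum_k (letter i k == c).
Proof.
rewrite /path_word count_map -sum1_count big_mkcond /= big_enum /=.
by apply: eq_bigr => k _ /=; case: eqP.
Qed.

Lemma path_wordP i c : c \in path_word i -> exists k, letter i k = c.
Proof. by case/mapP => k _ ->; exists k. Qed.

(** Serves to locate a letter that survives a contraction at [k0]: even if it equals the contracted
    letter, it can be read at another position. *)
Lemma other_position i k0 c : (letter i k0 == c) < count_mem c (path_word i) ->
  exists2 k, k != k0 & letter i k = c.
Proof.
rewrite count_path_word (bigD1 k0)//= -addn1 leq_add2l => h.
have /existsP[k /andP[kk0 /eqP kc]] : [exists k, (k != k0) && (letter i k == c)].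
  apply: contraTT h => /existsPn hk; rewrite -eqn0Ngt; apply/eqP.
  rewrite big1// => k kk0; have := hk k; rewrite kk0 /= => /negbTE ->.
  by [].
by exists k.
Qed.

(** Vertices up to [k0] are recovered forwards from the start. The later ones are recovered
    backwards, since the walk returns to its start and the symmetry of [lam] makes a letter
    determine either endpoint from the other. *)
Lemma path_closure i i' k0 : i ord0 = i' ord0 ->
  (forall k, k != k0 -> letter i k = letter i' k) -> i = i'.
Proof.
move=> h0 hk.
have fwd (m : nat) : forall k, k = m :> nat -> k <= k0 -> i k = i' k.
  elim: m => [|m IH] k km kk0.
    by rewrite (_ : k = ord0)//; apply: val_inj.
  have mp : m < p.+2 by have := ltn_ord k; rewrite km; lia.
  pose k' := Ordinal mp.
  have kE : ordS k' = k.
    apply: val_inj; rewrite /= modn_small -?km//.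
  have e : i k' = i' k' by apply: IH => //=; lia.
  have : letter i k' = letter i' k'.
    by apply: hk; apply: contraTneq kk0 => <- /=; rewrite -ltnNge km.
  by rewrite /letter kE e => /lamI.
have bwd (m : nat) : forall k, (p.+2 - k = m.+1)%N -> k0 < k -> i k = i' k.
  elim: m => [|m IH] k km k0k.
    have kE : ordS k = ord0.
      apply: val_inj => /=; have -> : k.+1 = p.+2 by lia.
      by rewrite modnn.
    have : letter i k = letter i' k.
      by apply: hk; apply: contraTneq k0k => ->; rewrite ltnn.
    by rewrite /letter kE h0 lamC [RHS]lamC => /lamI.
  have kE : ordS k = k.+1 :> nat by rewrite /= modn_small//; lia.
  have e : i (ordS k) = i' (ordS k) by apply: IH; lia.
  have : letter i k = letter i' k.
    by apply: hk; apply: contraTneq k0k => ->; rewrite ltnn.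
  by rewrite /letter e lamC [RHS]lamC => /lamI.
apply/ffunP => k; have [kk0|k0k] := leqP k k0; first exact: fwd kk0.
by apply: (bwd (p.+2 - k).-1) => //; have := ltn_ord k; lia.
Qed.

Notation quad := {ffun bool * bool -> path}.
Notation pos := (bool * bool * ord_p)%type.
Implicit Types (r : {ffun bool * bool -> ord_p}) (b : {ffun bool -> bool})
  (e : {ffun bool -> ord_p}) (I : quad).

Definition qletter I (x : pos) := letter (I x.1) x.2.

(* The walk (s, false) produces the differentiated field, the walk (s, true) the
   gradient; s tells apart the two factors of Gamma^2. The letters at positions
   r are those contracted within each factor, and the walks (s, b s) share a
   letter, at positions e s, across the two factors. *)
Definition linked r b e I := [/\
  forall s, letter (I (s, false)) (r (s, false)) = letter (I (s, true)) (r (s, true)),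
  forall s, e s != r (s, b s),
  letter (I (false, b false)) (e false) = letter (I (true, b true)) (e true) &
  forall c, ~~ odd (\sum_x count_mem c (path_word (I x)))].

Definition unmatched r b e (x : pos) :=
  (x.2 != r x.1) && ~~ ((x.1.2 == b x.1.1) && (x.2 == e x.1.1)).

(** The six special positions are distinct, so every sum over positions splits. It is used with [F]
    constant to count the unmatched positions, and with the indicator of a letter to compare
    parities. *)
Lemma total_split r b e (F : pos -> nat) : (forall s, e s != r (s, b s)) ->
  \sum_x F x = \sum_(x | unmatched r b e x) F x +
    (\sum_x F (x, r x) + \sum_s F (s, b s, e s)).
Proof.
move=> er.
have -> : \sum_x F x = \sum_y \sum_k F (y, k).
  by rewrite pair_bigA /=; apply: eq_bigr => -[].
have -> : \sum_(x | unmatched r b e x) F x = \sum_y \sum_(k | unmatched r b e (y, k)) F (y, k).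
  rewrite (pair_big_dep xpredT (fun y k => unmatched r b e (y, k)) (fun y k => F (y, k))) /=.
  by apply: eq_big => [[]|[]].
have -> : \sum_s F (s, b s, e s) =
    \sum_y (if y.2 == b y.1 then F (y, e y.1) else 0).
  transitivity (\sum_(y : bool * bool) (if y.2 == b y.1 then F (y.1, y.2, e y.1) else 0));
    last by apply: eq_bigr => -[].
  rewrite -(pair_bigA _ (fun s m => if m == b s then F (s, m, e s) else 0)) /=.
  by apply: eq_bigr => s _; rewrite -big_mkcond big_pred1_eq.
rewrite -!big_split /=; apply: eq_bigr => -[s m] _ /=.
rewrite (bigD1 (r (s, m)))//= addnCA; congr (_ + _).
case: eqVneq => [->|mm0].
  rewrite (bigD1 (e s))/=; last exact: er.
  rewrite addnC; congr (_ + _); apply: eq_bigl => k.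
  by rewrite /unmatched /= eqxx.
by rewrite addn0; apply: eq_bigl => k; rewrite /unmatched /= (negbTE mm0) /= andbT.
Qed.

Lemma sum_bool2 (F : bool * bool -> nat) :
  \sum_x F x = \sum_s (F (s, false) + F (s, true)).
Proof.
transitivity (\sum_x F (x.1, x.2)); first by apply: eq_bigr => -[].
rewrite -(pair_bigA _ (fun s m => F (s, m))) /=.
by apply: eq_bigr => s _; rewrite big_bool addnC.
Qed.

Lemma sum_bool (F : bool -> nat) : \sum_s F s = F false + F true.
Proof. by rewrite big_bool addnC. Qed.

(* The unmatched letters form an even word of size 4(p+2) - 6, hence take at most
   2p + 1 values. *)
Lemma linked_code r b e I : linked r b e I ->
  exists zr : {ffun 'I_(p.*2.+1) -> 'I_B} * {ffun pos -> 'I_(p.*2.+1)},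
    forall x, unmatched r b e x -> qletter I x = zr.1 (zr.2 x).
Proof.
move=> [h1 h2 h3 h4].
pose s := [seq qletter I x | x <- enum (unmatched r b e)].
have cs c : count_mem c s = \sum_(x | unmatched r b e x) (qletter I x == c).
  rewrite /s count_map -sum1_count big_mkcond /= big_enum /=.
  by apply: eq_bigr => x _ /=; case: eqP.
have es : even_word s.
  move=> c; rewrite cs.
  have := h4 c.
  rewrite (_ : \sum_x _ = \sum_x (qletter I x == c)); last first.
    under eq_bigr do rewrite count_path_word.
    by rewrite pair_bigA /=; apply: eq_bigr => -[].
  (* By [h1] and [h3] the six special letters are equal in pairs, so dropping them preserves the
     parity of each multiplicity. *)
  rewrite (total_split _ h2) sum_bool2 !sum_bool /qletter /= h3 !h1.
  by rewrite !addnn !oddD !odd_double !addbF.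
have ss : size s = p.*2.+1.*2.
  rewrite size_map -cardE -sum1_card.
  have := @total_split r b e (fun=> 1) h2.
  rewrite !sum_nat_const !card_prod !card_bool !card_ord.
  set f := #|_|; lia.
have [q hq] := even_word_half es.
have sq : size q = p.*2.+1.
  by move/perm_size: hq; rewrite ss size_cat; lia.
have qB (j : 'I_(p.*2.+1)) : nth 0 q j < B.
  have : nth 0 q j \in s by rewrite (perm_mem hq) mem_cat mem_nth// sq.
  by case/mapP => x _ ->; exact: lamB.
(* [q] becomes a table of letters, and each position is sent to an index in that table. *)
exists ([ffun j => Ordinal (qB j)], [ffun x => inord (index (qletter I x) q)]).
move=> x hx; rewrite !ffunE /=.
have xq : qletter I x \in q.
  have : qletter I x \in s by apply/mapP; exists x; rewrite ?mem_enum.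
  by rewrite (perm_mem hq) mem_cat orbb.
by rewrite inordK ?nth_index// -sq index_mem.
Qed.

(* The walks (s, ~~ b s) are recovered first, which supplies the letter at
   position r of the walks (s, b s). *)
Lemma linked_inj r b e I I' : linked r b e I -> linked r b e I' ->
  (forall y, I y ord0 = I' y ord0) ->
  (forall x, unmatched r b e x -> qletter I x = qletter I' x) -> I = I'.
Proof.
move=> [h1 h2 _ _] [h1' _ _ _] h0 hfree.
have leaf s : I (s, ~~ b s) = I' (s, ~~ b s).
  apply: (@path_closure _ _ (r (s, ~~ b s))) => // k kr.
  apply: (hfree (s, ~~ b s, k)); rewrite /unmatched /= kr /=.
  by case: (b s).
have inner s : I (s, b s) = I' (s, b s).
  apply: (@path_closure _ _ (e s)) => // k ke.
  have [->|kr] := eqVneq k (r (s, b s)); last first.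
    by apply: (hfree (s, b s, k)); rewrite /unmatched /= kr /= (negbTE ke) andbF.
  have sym (J : quad) :
      letter (J (s, false)) (r (s, false)) = letter (J (s, true)) (r (s, true)) ->
      letter (J (s, b s)) (r (s, b s)) = letter (J (s, ~~ b s)) (r (s, ~~ b s)).
    by case: (b s).
  by rewrite (sym _ (h1 s)) (sym _ (h1' s)) leaf.
apply/ffunP => -[s m].
by have [->|] := eqVneq m (b s); [exact: inner|case: m (b s) (leaf s) => -[]].
Qed.

(** The three factors count the starting points, the tables of [p.*2.+1] letters and the maps from
    positions to table entries. *)
Lemma card_linked r b e :
  #|[set I : quad | `[< linked r b e I >]]| <=
    n ^ 4 * (B ^ p.*2.+1 * p.*2.+1 ^ (4 * p.+2)).
Proof.
set S := [set I | _].
(* A member of [S] provides the default code [z0] that [pick] requires. *)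
have [->|[I0]] := set_0Vmem S; first by rewrite cards0.
rewrite finset.in_set => /asboolP/linked_code[z0 _].
pose ok (I : quad) (z : {ffun 'I_(p.*2.+1) -> 'I_B} * {ffun pos -> 'I_(p.*2.+1)}) :=
  `[< forall x, unmatched r b e x -> qletter I x = z.1 (z.2 x) >].
pose code I := ([ffun y => I y ord0] : {ffun bool * bool -> 'I_n},
  odflt z0 [pick z | ok I z]).
have codeP I : linked r b e I -> ok I (code I).2.
  move=> /linked_code[z hz]; rewrite /code /=.
  by case: pickP => [//|/(_ z)/asboolP].
have inj : {in S &, injective code}.
  move=> I I'; rewrite !finset.in_set => /asboolP hI /asboolP hI' eqc.
  apply: (linked_inj hI hI') => [y|x fx].
    by have /(congr1 (fun c => c.1))/ffunP/(_ y) := eqc; rewrite /= !ffunE.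
  have /asboolP/(_ x fx) -> := codeP _ hI; have /asboolP/(_ x fx) -> := codeP _ hI'.
  by rewrite eqc.
rewrite -(card_in_imset inj); apply: leq_trans (max_card _) _.
by rewrite !card_prod !card_ffun !card_prod !card_bool !card_ord.
Qed.

Definition is_linked I := [exists r, [exists b, [exists e, `[< linked r b e I >]]]].

(** Union bound over the four contracted positions [r], the two choices [b] of a walk and the two
    positions [e] of the shared letter. *)
Lemma card_is_linked : #|[set I : quad | is_linked I]| <=
  p.+2 ^ 4 * 2 ^ 2 * p.+2 ^ 2 * (n ^ 4 * (B ^ p.*2.+1 * p.*2.+1 ^ (4 * p.+2))).
Proof.
set c := (X in _ <= _ * X).
apply: (@leq_trans (\sum_(y : {ffun bool * bool -> ord_p} * {ffun bool -> bool} * {ffun bool -> ord_p})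
    #|[set I : quad | `[< linked y.1.1 y.1.2 y.2 I >]]|)).
  rewrite -sum1_card big_mkcond /=.
  under [X in _ <= X]eq_bigr do rewrite -sum1_card big_mkcond.
  rewrite exchange_big; apply: leq_sum => I _ /=; rewrite inE.
  case: ifP => // /existsP[r /existsP[b /existsP[e h]]].
  by rewrite (bigD1 (r, b, e))//= inE h.
apply: (@leq_trans (\sum_(y : {ffun bool * bool -> ord_p} * {ffun bool -> bool} * {ffun bool -> ord_p}) c)).
  by apply: leq_sum => y _; exact: card_linked.
by rewrite sum_nat_const !card_prod !card_ffun !card_prod !card_bool !card_ord.
Qed.

(** Passing from the two walks to [t] deletes both copies of the contracted letter and the pairs
    discarded by the field, whence [q ++ q]. The boolean [m] tells which walk carries a surviving
    letter. *)
Lemma kernel_side i i' t : t \in pair_kernel (path_word i) (path_word i') ->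
  exists k k', [/\ letter i k = letter i' k',
    forall c, c \in t -> exists (m : bool) l, l != (if m then k' else k) /\
       letter (if m then i' else i) l = c &
    exists q, perm_eq (path_word i ++ path_word i') (t ++ q ++ q)].
Proof.
move=> /pair_kernelP[j [v [q [hq jw ->]]]].
have [k hk] : exists k, letter i k = j.
  by apply: path_wordP; rewrite (perm_mem hq) mem_head.
have [k' hk'] := path_wordP jw.
exists k, k'; split; first by rewrite hk.
- move=> c; rewrite mem_cat => /orP[cv|cr].
    have [|l lk lc] := @other_position i k c.
      move/permP: hq => -> /=; rewrite hk count_cat.
      have c0 : 0 < count_mem c v by rewrite -has_count has_pred1.
      by rewrite -[ltnLHS]addn0 ltn_add2l addn_gt0 c0.
    by exists false, l.
  have [|l lk lc] := @other_position i' k' c.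
    have /permP -> := perm_to_rem jw; rewrite /= hk'.
    have c0 : 0 < count_mem c (rem j (path_word i')) by rewrite -has_count has_pred1.
    by rewrite -[ltnLHS]addn0 ltn_add2l.
  by exists true, l.
- exists (j :: q); have /permP h := perm_to_rem jw; move/permP: hq => hq.
  by apply/permP => P; rewrite !count_cat h hq /= !count_cat /=; lia.
Qed.

(** The contractions supply [r], a common letter of [t] and [t'] supplies [b] and [e], and the
    deleted pairs do not alter the parity of the multiplicities. *)
Lemma kernel_linked I t t' :
  t \in pair_kernel (path_word (I (false, false))) (path_word (I (false, true))) ->
  t' \in pair_kernel (path_word (I (true, false))) (path_word (I (true, true))) ->
  has (mem t) t' -> even_word (t ++ t') -> is_linked I.
Proof.
move=> /kernel_side[k00 [k01 [h0 hc0 [q0 hq0]]]] /kernel_side[k10 [k11 [h1 hc1 [q1 hq1]]]].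
move=> /hasP[c ct' ct] ett.
have [m0 [l0 [ne0 lc0]]] := hc0 _ ct; have [m1 [l1 [ne1 lc1]]] := hc1 _ ct'.
apply/existsP; exists [ffun y : bool * bool => if y.1 then if y.2 then k11 else k10 else if y.2 then k01 else k00].
apply/existsP; exists [ffun s : bool => if s then m1 else m0].
apply/existsP; exists [ffun s : bool => if s then l1 else l0].
apply/asboolP; split.
- by case; rewrite !ffunE.
- by case; rewrite !ffunE.
- by rewrite !ffunE; move: lc0 lc1; case: (m0) (m1) => -[] -> ->.
- move=> a; have e0 := permP hq0 (pred1 a); have e1 := permP hq1 (pred1 a).
  rewrite !count_cat in e0 e1; rewrite sum_bool2 sum_bool e0 e1.
  have := ett a; rewrite !count_cat.
  by rewrite !addnn !oddD !odd_double !addbF.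
Qed.

End Paths.

(** * Covariance of the kernel words *)

Section PathKernel.
Variables (n p B : nat) (lam : 'I_n -> 'I_n -> nat).
Hypothesis lamC : forall a b, lam a b = lam b a.
Hypothesis lamI : forall a, injective (lam a).
Hypothesis lamB : forall a b, lam a b < B.

Notation path := {ffun 'I_p.+2 -> 'I_n}.
Notation word := (@path_word n p lam).
Notation quad := {ffun bool * bool -> path}.

Definition path_words : seq (seq nat) := [seq word i | i : path].

Lemma sum_path_words (V : nmodType) (F : seq nat -> V) :
  (\sum_(w <- path_words) F w = \sum_i F (word i))%R.
Proof. by rewrite /path_words big_map big_enum. Qed.

Lemma sum_quad (F : path -> path -> path -> path -> nat) :
  \sum_i1 \sum_i2 \sum_i3 \sum_i4 F i1 i2 i3 i4 =
  \sum_(I : quad) F (I (false, false)) (I (false, true)) (I (true, false)) (I (true, true)).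
Proof.
rewrite pair_bigA /=; under eq_bigr do rewrite pair_bigA /=.
rewrite pair_bigA /=.
rewrite (reindex (fun I : quad => ((I (false, false), I (false, true)), (I (true, false), I (true, true)))))//=.
exists (fun x : path * path * (path * path) => [ffun y : bool * bool =>
   if y.1 then (if y.2 then x.2.2 else x.2.1) else (if y.2 then x.1.2 else x.1.1)]) => [I _|[[i1 i2] [i3 i4]] _] /=.
  by apply/ffunP => -[[] []]; rewrite ffunE.
by rewrite !ffunE.
Qed.

Lemma wick_cat_le t t' b : size t + size t' <= b ->
  wick (t ++ t') <= wick t * wick t' +
    (if has (mem t) t' && (0 < wick (t ++ t')) then b`! else 0).
Proof.
move=> tb; have [h|h] := boolP (has (mem t) t'); last first.
  by rewrite wick_cat_disjoint// leq_addr.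
case: posnP => [->//|_] /=.
apply: leq_trans (leq_addl _ _); apply: leq_trans (wick_le_fact _) _.
by rewrite size_cat; exact: leq_fact.
Qed.

(** After subtraction of (E Gamma)^2 only pairs of kernel words with a common letter and an even
    concatenation remain, and these come from linked quadruples. The first factorial bounds the Wick
    mean of the concatenation; the squared factor bounds the number of pairs of kernel words per
    quadruple. *)
Lemma kernel_covariance :
  \sum_(t <- stein_kernel path_words) \sum_(t' <- stein_kernel path_words) wick (t ++ t') <=
  (\sum_(t <- stein_kernel path_words) wick t) ^ 2 +
  (4 * p.+2)`! * (p.+2`! * p.+2) ^ 2 * #|[set I : quad | is_linked lam I]|.
Proof.
set K := stein_kernel _.
have szK t : t \in K -> size t <= 2 * p.+2.
  move=> /flatten_mapP[w1 /mapP[i1 _ ->]] /flatten_mapP[jv hjv] /flatten_mapP[w2 /mapP[i2 _ ->]] ht.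
  have : t \in pair_kernel (word i1) (word i2).
    by apply/flatten_mapP; exists jv.
  by move/size_pair_kernel_word; rewrite !size_path_word mul2n addnn.
pose lk t t' := if has (mem t) t' && (0 < wick (t ++ t')) then (4 * p.+2)`! else 0.
apply: (@leq_trans (\sum_(t <- K) \sum_(t' <- K) (wick t * wick t' + lk t t'))).
  rewrite big_seq [leqRHS]big_seq; apply: leq_sum => t tK.
  rewrite big_seq [leqRHS]big_seq; apply: leq_sum => t' tK'.
  by apply: wick_cat_le; rewrite (_ : 4 = 2 + 2)// mulnDl leq_add ?szK.
under eq_bigr do rewrite big_split /=.
rewrite big_split /= -mulnn big_distrlr /= leq_add2l.
rewrite /K stein_kernel_sum sum_path_words.
under eq_bigr do rewrite sum_path_words.
under eq_bigr => i1 _ do under eq_bigr => i2 _ do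
  under eq_bigr => t _ do rewrite stein_kernel_sum sum_path_words.
under eq_bigr => i1 _ do under eq_bigr => i2 _ do
  under eq_bigr => t _ do under eq_bigr => i3 _ do rewrite sum_path_words.
apply: (@leq_trans (\sum_i1 \sum_i2 \sum_i3 \sum_i4
   \sum_(t <- pair_kernel (word i1) (word i2))
   \sum_(t' <- pair_kernel (word i3) (word i4)) lk t t')).
  apply: leq_sum => i1 _; apply: leq_sum => i2 _; rewrite exchange_big.
  by apply: leq_sum => i3 _; rewrite exchange_big.
rewrite (sum_quad (fun i1 i2 i3 i4 => \sum_(t <- pair_kernel (word i1) (word i2))
   \sum_(t' <- pair_kernel (word i3) (word i4)) lk t t')).
rewrite -sum1_card big_distrr /= [leqRHS]big_mkcond /=.
apply: leq_sum => I _; rewrite inE muln1.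
set s := pair_kernel _ _; set s' := pair_kernel _ _.
have lkP t t' : t \in s -> t' \in s' -> lk t t' <= (if is_linked lam I then (4 * p.+2)`! else 0).
  move=> ts ts'; rewrite /lk; case: ifP => // /andP[h1 /wick_gt0P h2].
  by rewrite (kernel_linked ts ts' h1 h2).
apply: (@leq_trans (\sum_(t <- s) \sum_(t' <- s') (if is_linked lam I then (4 * p.+2)`! else 0))).
  rewrite big_seq [leqRHS]big_seq; apply: leq_sum => t tK.
  rewrite big_seq [leqRHS]big_seq; apply: leq_sum => t' tK'.
  exact: lkP.
rewrite !big_const_seq !iter_addn_0 !count_predT.
case: ifP => _; last by rewrite !mul0n.
rewrite -mulnA leq_mul2l; apply/orP; right.
rewrite mulnC -mulnn; apply: leq_mul; apply: leq_trans (size_pair_kernel _ _) _;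
  by rewrite !size_path_word.
Qed.

End PathKernel.

(** * Lower bound for the mean trace *)

Section MeanLowerBound.
Variables (n q : nat) (lam : 'I_n -> 'I_n -> nat).
Hypothesis lamC : forall a b, lam a b = lam b a.

Notation path := {ffun 'I_q.*2.+2 -> 'I_n}.
Notation word := (@path_word n q.*2 lam).

(* Walks alternating between a fixed vertex and arbitrary ones: each letter is
   used twice in a row, by symmetry of lam. *)
Definition zigzag_val (a : 'I_n) (c : {ffun 'I_q.+1 -> 'I_n}) (k : nat) :=
  if odd k then c (inord k./2) else a.

Definition zigzag (ac : 'I_n * {ffun 'I_q.+1 -> 'I_n}) : path :=
  [ffun k : 'I_q.*2.+2 => zigzag_val ac.1 ac.2 k].

Lemma zigzag_inj : injective zigzag.
Proof.
move=> [a c] [a' c'] /ffunP h; congr pair.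
  by have := h ord0; rewrite !ffunE.
apply/ffunP => j.
have jq : j.*2.+1 < q.*2.+2 by have := ltn_ord j; lia.
have := h (Ordinal jq); rewrite !ffunE /zigzag_val /= odd_double /=.
by rewrite uphalf_double inord_val.
Qed.

Lemma sum_ord_double (g : nat -> nat) m :
  \sum_(k < m.*2) g k = \sum_(j < m) (g j.*2 + g j.*2.+1).
Proof.
elim: m => [|m IH]; first by rewrite !big_ord0.
by rewrite doubleS !big_ord_recr /= IH addnA.
Qed.

Lemma even_word_zigzag ac : even_word (word (zigzag ac)).
Proof.
case: ac => a c x; rewrite count_path_word.
pose g k : nat := lam (zigzag_val a c k) (zigzag_val a c k.+1) == x.
rewrite (eq_bigr (fun k : 'I_q.*2.+2 => g k)); last first.
  move=> k _; rewrite /letter !ffunE /g /=; congr (nat_of_bool (lam _ _ == x)).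
  have := ltn_ord k; rewrite leq_eqVlt => /predU1P[->|kq].
    by rewrite modnn /zigzag_val /= odd_double.
  by rewrite modn_small.
rewrite (sum_ord_double g q.+1).
rewrite (eq_bigr (fun j : 'I_q.+1 => (g j.*2).*2)); last first.
  move=> j _; rewrite (_ : g j.*2.+1 = g j.*2) ?addnn//.
  by rewrite /g /zigzag_val /= !odd_double /= lamC.
apply: (big_ind (fun s => ~~ odd s)) => // [y z /negbTE oy oz|j _].
  by rewrite oddD oy.
by rewrite odd_double.
Qed.

(** Only the zigzag walks are kept: one fixed vertex and [q.+1] free ones, each walk having Wick
    mean at least 1. *)
Lemma sum_wick_ge : n ^ q.+2 <= \sum_(i : path) wick (word i).
Proof.
have -> : n ^ q.+2 = #|[set zigzag ac | ac in [set: 'I_n * {ffun 'I_q.+1 -> 'I_n}]]|.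
  by rewrite card_imset ?cardsT ?card_prod ?card_ffun ?card_ord//; exact: zigzag_inj.
rewrite -sum1_card [leqLHS]big_mkcond /=; apply: leq_sum => i _.
case: ifP => // /imsetP[ac _ ->].
by apply/wick_gt0P; exact: even_word_zigzag.
Qed.

End MeanLowerBound.

Lemma fact_leX b m : m <= b -> m`! <= b ^ m.
Proof.
elim: m => // m IH mb; rewrite factS expnS leq_mul// IH//.
exact: ltnW.
Qed.

(** The left side is what [kernel_covariance] and [card_is_linked] give for [B] = 2n once the powers
    of n are removed. Bounding every base by 4P gives the exponent 12P + 8, at most 16P because P is
    at least 2. *)
Lemma kernel_constant_le q (P := q.*2.+2) :
  (4 * P)`! * (P`! * P) ^ 2 * (P ^ 4 * 2 ^ 2 * P ^ 2 *
    (2 ^ q.*2.*2.+1 * q.*2.*2.+1 ^ (4 * P))) <= (4 * P) ^ (16 * P).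
Proof.
set b := 4 * P.
have b0 : 0 < b by rewrite /b /P; lia.
apply: (@leq_trans (b ^ (4 * P) * (b ^ P * b) ^ 2 * (b ^ 6 * (b ^ (2 * P) * b ^ (4 * P))))).
  apply: leq_mul; last apply: leq_mul; last apply: leq_mul.
  - apply: leq_mul; first exact: fact_leX.
    rewrite leq_exp2r//; apply: leq_mul; last by rewrite /b; lia.
    by apply: fact_leX; rewrite /b; lia.
  - by rewrite mulnAC -expnD /b expnMn [leqLHS]mulnC leq_mul.
  - apply: (@leq_trans (b ^ q.*2.*2.+1)).
      by rewrite leq_exp2r// /b /P; lia.
    by apply: leq_pexp2l => //; rewrite /P; lia.
  - by rewrite leq_exp2r ?muln_gt0// /b /P; lia.
rewrite -expnSr -expnM -!expnD; apply: leq_pexp2l => //.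
rewrite /P; lia.
Qed.

End Combinatorics.

Local Open Scope classical_set_scope.
Local Open Scope ring_scope.

(** * Gaussian integration by parts *)

Section SubGaussian.
Context {R : realType}.
Implicit Types F G : R -> R.

(** Growth below every Gaussian exponential. Quantifying over all [e] makes the class stable under
    products, by halving [e]; it contains polynomials and their compositions with Lipschitz
    functions. *)
Definition subgauss F :=
  forall e, 0 < e -> exists C, forall x, `|F x| <= C * expR (e * x ^+ 2).

Lemma subgauss_cst c : subgauss (fun=> c).
Proof.
move=> e e0; exists `|c| => x; rewrite ler_peMr// -expR0 ler_expR.
by rewrite mulr_ge0 ?sqr_ge0 // ltW.
Qed.

Lemma subgauss_id : subgauss (fun x => x).
Proof.
move=> e e0; exists (1 + e^-1) => x.
have h1 : e * x ^+ 2 <= expR (e * x ^+ 2).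
  by apply: le_trans (expR_ge1Dx _); rewrite lerDr.
have h2 : 1 <= expR (e * x ^+ 2).
  by rewrite -expR0 ler_expR mulr_ge0 ?sqr_ge0 // ltW.
apply: (@le_trans _ _ (1 + x ^+ 2)).
  rewrite -real_normK ?num_real//; have := normr_ge0 x; set y := `|x| => y0; nra.
rewrite mulrDl mul1r lerD// mulrC ler_pdivlMr// mulrC.
exact: h1.
Qed.

Lemma subgaussD F G : subgauss F -> subgauss G -> subgauss (fun x => F x + G x).
Proof.
move=> hF hG e e0; have [A hA] := hF _ e0; have [B hB] := hG _ e0.
exists (A + B) => x; rewrite mulrDl; apply: le_trans (ler_normD _ _) _.
exact: lerD.
Qed.

Lemma subgaussM F G : subgauss F -> subgauss G -> subgauss (fun x => F x * G x).
Proof.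
move=> hF hG e e0; have e2 : 0 < e / 2 by rewrite divr_gt0.
have [A hA] := hF _ e2; have [B hB] := hG _ e2.
exists (A * B) => x; rewrite normrM.
rewrite [X in expR (X * _)](splitr e) mulrDl expRD mulrACA.
exact: ler_pM.
Qed.

Lemma subgauss_le F G : (forall x, `|F x| <= `|G x|) -> subgauss G -> subgauss F.
Proof.
move=> FG hG e e0; have [A hA] := hG _ e0.
by exists A => x; exact: le_trans (FG x) (hA x).
Qed.

Lemma subgauss_norm F : subgauss F -> subgauss (fun x => `|F x|).
Proof. by apply: subgauss_le => x; rewrite normr_id. Qed.

Lemma subgaussX F n : subgauss F -> subgauss (fun x => F x ^+ n).
Proof.
move=> hF; elim: n => [|n IH].
  by under eq_fun do rewrite expr0; exact: subgauss_cst.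
by under eq_fun do rewrite exprS; exact: subgaussM.
Qed.

Definition lipschitz_deriv (K : R) (phi dphi : R -> R) :=
  [/\ forall x : R, is_derive x 1 phi (dphi x), continuous dphi &
      forall x, `|dphi x| <= K].

Lemma is_derive_continuous (f : R -> R) (x df : R) :
  is_derive x 1 f df -> {for x, continuous f}.
Proof.
by move=> [d _]; apply: differentiable_continuous; exact/derivable1_diffP.
Qed.

Lemma lipschitz_deriv_growth K phi dphi x : lipschitz_deriv K phi dphi ->
  `|phi x| <= `|phi 0| + K * `|x|.
Proof.
move=> [dp cd bd].
have cp : continuous phi by move=> y; exact: is_derive_continuous (dp y).
suff : `|phi x - phi 0| <= K * `|x|.
  have := ler_normD (phi x - phi 0) (phi 0); rewrite subrK; lra.
have [x0|x0] := leP x 0.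
- have [c _ h] := @MVT_segment _ phi dphi _ _ x0 (fun x _ => dp x)
    (continuous_subspaceT cp).
  by rewrite distrC h sub0r normrM normrN ler_wpM2r.
- have [c _ h] := @MVT_segment _ phi dphi _ _ (ltW x0) (fun x _ => dp x)
    (continuous_subspaceT cp).
  by rewrite h subr0 normrM ler_wpM2r.
Qed.

Lemma subgauss_lipschitz_comp K phi dphi F : lipschitz_deriv K phi dphi ->
  subgauss F -> subgauss (fun x => phi (F x)).
Proof.
move=> hphi hF.
apply: (@subgauss_le _ (fun x => `|phi 0| + K * `|F x|)).
  by move=> x; rewrite [leRHS]ger0_norm; [|apply: le_trans (normr_ge0 _) _];
    exact: lipschitz_deriv_growth hphi.
by apply: subgaussD; [|apply: subgaussM]; [exact: subgauss_cst..|exact: subgauss_norm].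
Qed.

Let mu := @lebesgue_measure R.
Local Notation pdf := (@normal_pdf R 0 1).

Lemma pdfE (x : R) : pdf x = normal_peak 1 * expR (- (x ^+ 2) / 2).
Proof.
by rewrite normal_pdfE ?oner_neq0// /normal_fun subr0 expr1n.
Qed.

Lemma is_derive_pdf (x : R) : is_derive x 1 pdf (- x * pdf x).
Proof.
have -> : pdf = (fun x => normal_peak 1 * expR (- (x ^+ 2) / 2)).
  by apply/funext => y; exact: pdfE.
have h : is_derive x 1 (fun y : R => - y ^+ 2 / 2) (- x).
  rewrite (_ : (fun y : R => _) = (cst (- 2^-1) * (id ^+ 2))); last first.
    by apply/funext => y /=; rewrite !fctE /=; field.
  by apply: is_derive_eq => /=; rewrite /GRing.scale/= !fctE /=; field.
have h2 := @is_derive1_comp _ expR (fun y : R => - y ^+ 2 / 2) x _ _ (is_derive_expR _) h.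
have h3 := is_deriveM (is_derive_cst (normal_peak 1 : R) x 1) h2.
by apply: (is_derive_eq h3); rewrite /GRing.scale/=; ring.
Qed.

Lemma subgauss_integrable F : measurable_fun setT F -> subgauss F ->
  mu.-integrable setT (fun x => (F x * pdf x)%:E).
Proof.
move=> mF /(_ (4^-1)) [|C hC]; first by rewrite invr_gt0.
have i2 : mu.-integrable setT (fun x => (normal_pdf 0 (Num.sqrt 2) x)%:E).
  exact: integrable_normal_pdf.
have s2 : Num.sqrt 2 != 0 :> R by rewrite sqrtr_eq0 -ltNge.
apply: (@le_integrable _ _ _ mu setT measurableT _
  (fun x => ((C * (normal_peak 1 / normal_peak (Num.sqrt 2))) * normal_pdf 0 (Num.sqrt 2) x)%:E)) => //=.
- apply/measurable_EFinP; apply: measurable_funM => //.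
  exact: measurable_normal_pdf.
- move=> z _; rewrite lee_fin; move: (z : R) => x.
  apply: le_trans (ler_norm _); rewrite normrM.
  rewrite (ger0_norm (normal_pdf_ge0 _ _ _)) pdfE.
  rewrite normal_pdfE// /normal_fun subr0 sqr_sqrtr//.
  have p0 := normal_peak_gt0 s2.
  rewrite [leRHS](_ : _ = normal_peak 1 * (C * expR (- x ^+ 2 / (2 *+ 2)))); last first.
    by field; rewrite gt_eqF.
  rewrite mulrCA ler_wpM2l ?normal_peak_ge0//.
  apply: (le_trans (ler_wpM2r (expR_ge0 _) (hC x))).
  rewrite -mulrA -expRD.
  by rewrite (_ : 4^-1 * x ^+ 2 + - x ^+ 2 / 2 = - x ^+ 2 / (2 *+ 2)) //; field.
- under eq_fun do rewrite EFinM; exact: integrableZl.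
Qed.

(** Stated through [u n ^+ 2] to cover both boundary terms, at n and at -n. The decay comes from
    exp(- n^2 / 4) <= 4 / (n + 1). *)
Lemma subgauss_pdf_cvg0 F (u : nat -> R) : (forall n, u n ^+ 2 = n%:R ^+ 2) ->
  subgauss F -> F (u n) * pdf (u n) @[n --> \oo] --> 0.
Proof.
move=> un /(_ (4^-1)) [|C hC]; first by rewrite invr_gt0.
have C0 : 0 <= C.
  have := hC 0; rewrite expr0n mulr0 expR0 mulr1; exact: le_trans.
apply/norm_cvg0P.
apply: (@squeeze_cvgr _ _ _ _ (cst 0)
  (fun n => C * normal_peak 1 * 4 * harmonic n)); last 2 first.
- exact: cvg_cst.
- rewrite -[X in _ --> X](mulr0 (C * normal_peak 1 * 4)).
  by apply: cvgM; [exact: cvg_cst|exact: cvg_harmonic].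
near=> n; rewrite normr_ge0 /= normrM pdfE un.
rewrite normrM (ger0_norm (normal_peak_ge0 _)) (ger0_norm (expR_ge0 _)).
rewrite mulrCA -!mulrA [leRHS]mulrCA ler_wpM2l ?normal_peak_ge0//.
have hn := hC (u n); rewrite un in hn.
apply: (le_trans (ler_wpM2r (expR_ge0 _) hn)).
rewrite -mulrA -expRD ler_wpM2l//.
rewrite (_ : _ + _ = - (4^-1 * n%:R ^+ 2)); last by field.
rewrite expRN -[4 * _]invrK lef_pV2 ?posrE ?expR_gt0// ?invr_gt0 ?mulr_gt0 ?invr_gt0//.
apply: le_trans (expR_ge1Dx _).
rewrite invfM invrK -[n.+1%:R]natr1; set y : R := n%:R.
have y0 : 0 <= y by rewrite ler0n.
nra.
Unshelve. all: by end_near. Qed.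

(** The derivative of [F * pdf] is (F' - x F) pdf. Its integral over growing symmetric intervals is
    a boundary term tending to 0, and dominated convergence passes to the whole line. *)
Lemma gauss_ibp F (dF : R -> R) : (forall x : R, is_derive x 1 F (dF x)) ->
  continuous dF -> subgauss F -> subgauss dF ->
  (\int[mu]_x (x * F x * pdf x)%:E = \int[mu]_x (dF x * pdf x)%:E)%E.
Proof.
move=> dFE cdF gF gdF.
have cF : continuous F by move=> x; exact: is_derive_continuous (dFE x).
have cpdf : continuous pdf by exact: continuous_normal_pdf.
have mc (f : R -> R) : continuous f -> measurable_fun setT f.
  exact: continuous_measurable_fun.
pose dG x := (dF x - x * F x) * pdf x.
have dGE x : is_derive x (1:R) (F * pdf) (dG x).
  have h := is_deriveM (dFE x) (is_derive_pdf x).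
  by apply: (is_derive_eq h); rewrite /dG /GRing.scale/=; ring.
have gxF : subgauss (fun x => x * F x).
  by apply: subgaussM => //; exact: subgauss_id.
have cxF : continuous (fun x : R => x * F x).
  by move=> x; apply: cvgM; [exact: cvg_id|exact: cF].
have cdG : continuous dG.
  by move=> x; apply: cvgM; [apply: cvgB; [exact: cdF|exact: cxF]|exact: cpdf].
have i1 := subgauss_integrable (mc _ cdF) gdF.
have i2 := subgauss_integrable (mc _ cxF) gxF.
have iG : mu.-integrable setT (EFin \o dG).
  rewrite (_ : EFin \o dG = (fun x => (dF x * pdf x)%:E) \-
    (fun x => (x * F x * pdf x)%:E))%E; last first.
    by apply/funext => x /=; rewrite /dG mulrBl EFinB.
  exact: integrableB.
suff h0 : (\int[mu]_x (EFin \o dG) x = 0)%E.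
  have -> : (\int[mu]_x (dF x * pdf x)%:E =
     \int[mu]_x ((x * F x * pdf x)%:E + (EFin \o dG) x))%E.
    apply: eq_integral => y _; move: (y : R) => x.
    by rewrite /= -EFinD; congr EFin; rewrite /dG; ring.
  by rewrite integralD// h0 adde0.
pose I n := `[- (n.+1%:R : R), n.+1%:R]%classic.
pose f_ n x := ((EFin \o dG) \_ (I n)) x.
have mG : measurable_fun setT (EFin \o dG) by exact: measurable_int iG.
have mI n : measurable (I n) by exact: measurable_itv.
have mf n : measurable_fun setT (f_ n).
  by apply/(measurable_restrictT _ (mI n)); exact: measurable_funTS.
have ff : {ae mu, forall x, setT x -> f_ ^~ x @ \oo --> (EFin \o dG) x}.
  apply: aeW => z _; move: (z : R) => x; apply: cvg_near_cst.
  near=> n; rewrite /f_ patchE mem_set// /I /= in_itv/= -ler_norml.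
  near: n; apply: filterS (nbhs_infty_ger `|x|) => n /le_trans; apply.
  by rewrite ler_nat.
have fG : {ae mu, forall x n, setT x -> `|f_ n x| <= (abse \o (EFin \o dG)) x}%E.
  apply: aeW => x n _; rewrite /f_ patchE; case: ifPn => // _.
  by rewrite abse0 /= lee_fin.
have [_ _ h] := @dominated_convergence _ _ _ mu setT measurableT f_ (EFin \o dG)
  (abse \o (EFin \o dG)) mf mG ff (integrable_abse iG) fG.
apply: (cvg_unique _ h) => //.
have -> : (fun n => \int[mu]_x f_ n x)%E =
   (fun n => (F n.+1%:R * pdf n.+1%:R - F (- n.+1%:R) * pdf (- n.+1%:R))%:E).
  apply/funext => n; rewrite /f_ -integral_mkcond.
  rewrite (@continuous_FTC2 _ dG (F * pdf))//.
  - by rewrite gtrN.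
  - exact: continuous_subspaceT.
  - split=> [x _||].
    + by have [] := dGE x.
    + by apply: cvg_at_right_filter; exact: is_derive_continuous (dGE _).
    + by apply: cvg_at_left_filter; exact: is_derive_continuous (dGE _).
  - by move=> x _; rewrite derive1E; exact: derive_val.
apply: cvg_EFin; first by near=> n.
have H : F n%:R * pdf n%:R - F (- n%:R) * pdf (- n%:R) @[n --> \oo] --> 0.
  rewrite -[X in _ --> X](subr0 0).
  by apply: cvgB; apply: subgauss_pdf_cvg0 => // n; rewrite sqrrN.
by move: H; rewrite -cvg_shiftS.
Unshelve. all: by end_near. Qed.

End SubGaussian.

(** * Integrals against the law of a Gaussian input *)

Section GaussianLaw.
Context {R : realType}.
Let mu := @lebesgue_measure R.
Local Notation pdf := (@normal_pdf R 0 1).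
Local Open Scope ereal_scope.

Lemma ge0_integral_normal_prob (f : R -> \bar R) :
  measurable_fun setT f -> (forall x, 0 <= f x) ->
  \int[normal_prob (0 : R) (1 : R)]_x f x = \int[mu]_x (f x * (pdf x)%:E).
Proof.
move=> mf f0.
have dom := normal_prob_dominates (0 : R) (1 : R).
rewrite -(Radon_Nikodym_SigmaFinite.change_of_variables dom)//.
apply: ae_eq_integral => //.
- apply: emeasurable_funM => //.
  exact: measurable_int (Radon_Nikodym_SigmaFinite.f_integrable dom).
- apply: emeasurable_funM => //=; apply/measurableT_comp => //=.
  exact: measurable_normal_pdf.
- apply: ae_eqe_mul2l => /=.
  apply: integral_ae_eq => //=.
  + exact: Radon_Nikodym_SigmaFinite.f_integrable.
  + by apply/measurableT_comp =>//; exact: measurable_normal_pdf.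
  + by move=> E _ mE; rewrite -Radon_Nikodym_SigmaFinite.f_integral.
Qed.

Context {d} {T : measurableType d} (P : probability T R).
Variable (X : {RV P >-> R}).
Hypothesis hX : forall B : set R, measurable B ->
  distribution P X B = normal_prob 0 1 B.

Lemma ge0_integral_gaussian (f : R -> \bar R) :
  measurable_fun setT f -> (forall x, 0 <= f x) ->
  \int[distribution P X]_x f x = \int[mu]_x (f x * (pdf x)%:E).
Proof.
move=> mf f0; rewrite -ge0_integral_normal_prob//.
(* The identity, seen as a map between the two displays of the Borel sigma-algebra. *)
pose g : measurableTypeR R -> R := fun x => x.
have mg : measurable_fun setT g by exact: measurable_id.
transitivity (\int[pushforward (normal_prob 0 1) g]_x f x).
  by apply: eq_measure_integral => A mA _; exact: hX.
by rewrite ge0_integral_pushforward.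
Qed.

Lemma integral_gaussian (f : R -> R) : measurable_fun setT f -> subgauss f ->
  \int[distribution P X]_x (f x)%:E = \int[mu]_x (f x * pdf x)%:E.
Proof.
move=> mf gf.
rewrite integralE [RHS]integralE.
congr (_ - _).
- rewrite ge0_integral_gaussian//; last first.
    by apply: measurable_funepos; exact/measurable_EFinP.
  apply: eq_integral => y _; move: (y : R) => x.
  rewrite !funeposE /= -!EFin_max -EFinM; congr EFin.
  by rewrite maxr_pMl ?normal_pdf_ge0// mul0r.
- rewrite ge0_integral_gaussian//; last first.
    by apply: measurable_funeneg; exact/measurable_EFinP.
  apply: eq_integral => y _; move: (y : R) => x.
  rewrite !funenegE /= -!EFin_max -EFinM; congr EFin.
  by rewrite maxr_pMl ?normal_pdf_ge0// mul0r mulNr.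
Qed.

Lemma gaussian_integrable (f : R -> R) : measurable_fun setT f -> subgauss f ->
  P.-integrable setT (fun w => (f (X w))%:E).
Proof.
move=> mf gf; apply/integrableP; split.
  by apply/measurable_EFinP; exact: measurableT_comp.
have h := ge0_integral_distribution X (f := fun x => `|f x|%:E).
rewrite (_ : \int[P]_x _ = \int[P]_x ((fun x => `|f x|%:E) \o X) x)//.
rewrite -h; last 2 first.
- by apply/measurable_EFinP; exact: measurableT_comp.
- by move=> y; rewrite lee_fin.
rewrite integral_gaussian; [|exact: measurableT_comp|exact: subgauss_norm].
have /integrableP[_] := subgauss_integrable mf gf.
under eq_integral do rewrite /= normrM (ger0_norm (normal_pdf_ge0 _ _ _)).
by [].
Qed.

End GaussianLaw.

(** * Independence of one input from all the others *)

Section Resampling.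
Context {R : realType} {d} {T : measurableType d} (P : probability T R).
Variable (X : nat -> {RV P >-> R}).
Hypothesis hX : gaussian_input P X.
Variable j : nat.

Definition cylinders : set (set T) := [set A | exists (J : {fset nat}) (B : nat -> set R),
  [/\ forall i, measurable (B i), j \notin J &
      A = \bigcap_(i in [set` J]) X i @^-1` B i]].

Lemma cylindersI : setI_closed cylinders.
Proof.
move=> _ _ [J1 [B1 [mB1 j1 ->]]] [J2 [B2 [mB2 j2 ->]]].
exists (J1 `|` J2)%fset, (fun i => (if i \in J1 then B1 i else setT) `&`
  (if i \in J2 then B2 i else setT)); split.
- by move=> i; apply: measurableI; case: ifP.
- by rewrite in_fsetU negb_or j1.
- apply/seteqP; split => w.
  + move=> [h1 h2] i /=; rewrite in_fsetU => hi; split.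
      by case: ifPn => //; exact: h1.
    by case: ifPn => //; exact: h2.
  + move=> h; split => i /= hi.
      by have := h i; rewrite /= in_fsetU hi => /(_ isT) [].
    by have := h i; rewrite /= in_fsetU hi orbT => /(_ isT) [].
Qed.

Lemma cylinders_measurable A : cylinders A -> measurable A.
Proof.
move=> [J [B [mB _ ->]]].
apply: fin_bigcap_measurable => // i _.
by rewrite -[X in measurable X]setTI; apply: measurable_funPT.
Qed.

Lemma cylindersT : cylinders setT.
Proof.
exists fset0, (fun=> setT); split => //.
by apply/seteqP; split => // w _ i.
Qed.

Let T' := g_sigma_algebraType cylinders.

Lemma sigma_cylinders_measurable (A : set T) :
  <<s cylinders >> A -> measurable A.
Proof.
apply: smallest_sub; first exact: sigma_algebra_measurable.
exact: cylinders_measurable.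
Qed.

(** The identity onto the coarser sigma-algebra: its law is [P] restricted to the events generated
    by the other inputs. *)
Definition to_cylinders (w : T) : T' := w.

Lemma measurable_to_cylinders : measurable_fun setT to_cylinders.
Proof. by move=> _ A mA; rewrite setTI; exact: sigma_cylinders_measurable. Qed.

HB.instance Definition _ := isMeasurableFun.Build _ _ _ _ to_cylinders
  measurable_to_cylinders.

Definition sample_pair (w : T) : R * T' := (X j w, w).

Lemma measurable_sample_pair : measurable_fun setT sample_pair.
Proof.
by apply: measurable_fun_pair => //; exact: measurable_to_cylinders.
Qed.

HB.instance Definition _ := isMeasurableFun.Build _ _ _ _ sample_pair
  measurable_sample_pair.

(** For fixed [A] both sides are finite measures in [B]. They agree on cylinders by independence of
    finite families, and cylinders are stable under intersection. *)
Lemma indep_cylinders (A : set R) (B : set T') : measurable A -> measurable B ->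
  P (X j @^-1` A `&` B) = (P (X j @^-1` A) * P B)%E.
Proof.
move=> mA mB.
have mXA : measurable (X j @^-1` A).
  by rewrite -[X in measurable X]setTI; apply: measurable_funPT.
pose c : {nonneg R} := NngNum (fine_ge0 (measure_ge0 P (X j @^-1` A))).
pose m1 := distribution P to_cylinders.
pose m2 := pushforward (mrestr P mXA) to_cylinders.
have U : \bigcup_(k : nat) (setT : set T') = setT by exact: bigcup_const.
have cE : (c%:num)%:E = P (X j @^-1` A) by rewrite fineK// fin_num_measure.
have := @measure_unique _ R T' cylinders (fun=> setT) erefl cylindersI
  (fun=> cylindersT) U m2 (mscale c m1) _ _ B mB.
rewrite /m2 /pushforward /= /mscale /= /mrestr cE /m1 /distribution /pushforward /=.
move=> key; rewrite setIC; apply: key; first exact: measurable_to_cylinders; last first.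
  move=> _; apply: (le_lt_trans (probability_le1 _ _)); last exact: ltry.
  by apply: measurableI => //; exact: measurableT.
move=> C [J [E [mE jJ ->]]].
rewrite [X in (X `&` _)](_ : _ = \bigcap_(i in [set` J]) X i @^-1` E i)//.
have [ind _] := hX.
pose E' i := if i == j then A else E i.
have mE' i : measurable (E' i) by rewrite /E'; case: ifP.
have := ind (j |` J)%fset E' mE'.
have := ind J E mE.
rewrite big_fsetU1//= /E' eqxx => h1.
rewrite (_ : \prod_(i <- J) _ = \prod_(i <- J) P (X i @^-1` E i))%E; last first.
  apply: eq_big_seq => i iJ; case: eqVneq iJ => // -> iJ.
  by rewrite iJ in jJ.
rewrite -h1 => <-; congr (P _).
apply/seteqP; split => w.
  move=> [h2 h3] i /=; rewrite in_fset1U => /orP[/eqP->|iJ]; first by rewrite eqxx.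
  by case: eqVneq => [->//|_]; exact: h2.
move=> h2; split => [i /= iJ|].
  have := h2 i; rewrite /= in_fset1U iJ orbT => /(_ isT).
  by case: eqVneq iJ => // -> iJ; rewrite iJ in jJ.
by have := h2 j; rewrite /= in_fset1U eqxx => /(_ isT).
Qed.

Lemma sample_pair_law (A : set (R * T')) : measurable A ->
  (distribution P (X j) \x distribution P to_cylinders)%E A =
  distribution P sample_pair A.
Proof.
move=> mA; apply: product_measure_unique => // B C mB mC.
rewrite /distribution /pushforward /= -indep_cylinders//.
Qed.

Lemma measurable_cylinder_coord i : i != j ->
  measurable_fun setT (X i : T' -> R).
Proof.
move=> ij _ B mB; rewrite setTI; apply: sub_sigma_algebra.
exists [fset i]%fset, (fun=> B); split => //.
- by rewrite in_fset1 eq_sym.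
- apply/seteqP; split=> w /=.
    by move=> h k /=; rewrite in_fset1 => /eqP ->.
  by apply; rewrite /= in_fset1.
Qed.

(* The sigma-algebra generated by the other inputs, on T itself, plays the role
   of the remaining coordinates of an infinite product space. *)
Lemma resample (H : R * T' -> \bar R) : measurable_fun setT H ->
  P.-integrable setT (fun w => H (X j w, w)) ->
  (\int[P]_w H (X j w, w) =
   \int[distribution P to_cylinders]_w \int[distribution P (X j)]_x H (x, w))%E.
Proof.
move=> mH iH.
have iH' : (distribution P (X j) \x distribution P to_cylinders)%E.-integrable setT H.
  have : (distribution P sample_pair).-integrable setT H.
    exact: integrable_pushforward.
  move=> /integrableP[_ h]; apply/integrableP; split => //.
  rewrite (eq_measure_integral (distribution P sample_pair))// => A mA _.
  exact: sample_pair_law.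
rewrite -(@integral_distribution _ _ _ _ _ P sample_pair H)//.
transitivity (\int[distribution P (X j) \x distribution P to_cylinders]_z H z)%E.
  by apply: eq_measure_integral => A mA _; apply/esym; exact: sample_pair_law.
by rewrite -integral21_prod_meas1.
Qed.

(** Resampling freezes the other inputs, so that the one-dimensional integration by parts applies
    under the outer integral. *)
Lemma resample_ibp (F dF : R -> T -> R) :
  (forall w (x : R), is_derive x 1 (F^~ w) (dF x w)) ->
  (forall w, continuous (dF^~ w)) ->
  (forall w, subgauss (F^~ w)) -> (forall w, subgauss (dF^~ w)) ->
  measurable_fun setT (fun z : R * T' => F z.1 z.2) ->
  measurable_fun setT (fun z : R * T' => dF z.1 z.2) ->
  P.-integrable setT (fun w => (X j w * F (X j w) w)%:E) ->
  P.-integrable setT (fun w => (dF (X j w) w)%:E) ->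
  (\int[P]_w (X j w * F (X j w) w)%:E = \int[P]_w (dF (X j w) w)%:E)%E.
Proof.
move=> FdF cdF gF gdF mF mdF iF idF.
rewrite (@resample (fun z => (z.1 * F z.1 z.2)%:E))//; last first.
  by apply/measurable_EFinP; apply: measurable_funM.
rewrite (@resample (fun z => (dF z.1 z.2)%:E))//; last exact/measurable_EFinP.
apply: eq_integral => w _ /=.
have cF : continuous (F^~ w) by move=> x; exact: is_derive_continuous (FdF w x).
rewrite integral_gaussian//; last 3 first.
- by have [_] := hX; exact.
- apply: measurable_funM => //; exact: continuous_measurable_fun.
- by apply: subgaussM; [exact: subgauss_id|exact: gF].
rewrite [RHS]integral_gaussian//; last 2 first.
- by have [_] := hX; exact.
- exact: continuous_measurable_fun.
exact: gauss_ibp.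
Qed.

End Resampling.

(** * Words as polynomials in the inputs *)

Section Words.
Context {R : realType}.
Implicit Types (x : nat -> R) (w v : seq nat) (gs : seq (seq nat)).

Definition mon x w : R := \prod_(l <- w) x l.

Definition weval x gs : R := \sum_(w <- gs) mon x w.

Definition wpartial j x gs : R :=
  \sum_(w <- gs) (count_mem j w)%:R * mon x (rem j w).

Definition update x j (t : R) : nat -> R := fun i => if i == j then t else x i.

Lemma mon_cons x a w : mon x (a :: w) = x a * mon x w.
Proof. by rewrite /mon big_cons. Qed.

Lemma mon_nil x : mon x [::] = 1.
Proof. by rewrite /mon big_nil. Qed.

Lemma mon_cat x w v : mon x (w ++ v) = mon x w * mon x v.
Proof. by rewrite /mon big_cat. Qed.

Lemma perm_mon x w v : perm_eq w v -> mon x w = mon x v.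
Proof. exact: perm_big. Qed.

Lemma mon_rem x j w :
  (count_mem j w)%:R * (x j * mon x (rem j w)) = (count_mem j w)%:R * mon x w.
Proof.
have [jw|/count_memPn ->] := boolP (j \in w); last by rewrite !mul0r.
by rewrite -mon_cons -(perm_mon _ (perm_to_rem jw)).
Qed.

Lemma is_derive_mon x j w (t : R) :
  is_derive t 1 (fun s => mon (update x j s) w)
    ((count_mem j w)%:R * mon (update x j t) (rem j w)).
Proof.
elim: w => [|a w IH].
  by under eq_fun do rewrite mon_nil; rewrite mul0r; exact: is_derive_cst.
rewrite (_ : (fun s => _) = (fun s => update x j s a) * (fun s => mon (update x j s) w)); last first.
  by apply/funext => s; rewrite mon_cons.
have [->|aj] := eqVneq a j.
  have h : is_derive t 1 (fun s => update x j s j) 1.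
    under eq_fun do rewrite /update eqxx.
    exact: is_derive_id.
  apply: (is_derive_eq (is_deriveM h IH)); rewrite /GRing.scale/= eqxx.
  rewrite mulrCA mon_rem natrD mulrDl mulr1 mul1r addrC.
  by congr (_ + _).
have h : is_derive t 1 (fun s => update x j s a) 0.
  under eq_fun do rewrite /update (negbTE aj).
  exact: is_derive_cst.
apply: (is_derive_eq (is_deriveM h IH)); rewrite /GRing.scale/= (negbTE aj).
by rewrite mon_cons mulr0 addr0 add0n mulrCA.
Qed.

Lemma is_derive_weval x j gs (t : R) :
  is_derive t 1 (fun s => weval (update x j s) gs) (wpartial j (update x j t) gs).
Proof.
rewrite /weval /wpartial; elim: gs => [|w gs IH].
  by under eq_fun do rewrite big_nil; rewrite big_nil; exact: is_derive_cst.
under eq_fun do rewrite big_cons.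
by rewrite big_cons; apply: is_deriveD; exact: is_derive_mon.
Qed.

Lemma subgauss_mon x j w : subgauss (fun s => mon (update x j s) w).
Proof.
elim: w => [|a w IH].
  by under eq_fun do rewrite mon_nil; exact: subgauss_cst.
under eq_fun do rewrite mon_cons; apply: subgaussM => //.
rewrite /update; case: eqP => _; [exact: subgauss_id|exact: subgauss_cst].
Qed.

Lemma subgauss_sum (I : Type) (s : seq I) (F : I -> R -> R) :
  (forall i, subgauss (F i)) -> subgauss (fun y : R => \sum_(i <- s) F i y).
Proof.
move=> hF; elim: s => [|i s IH].
  by under eq_fun do rewrite big_nil; exact: subgauss_cst.
by under eq_fun do rewrite big_cons; exact: subgaussD.
Qed.

Lemma continuous_mon x j w : continuous (fun s => mon (update x j s) w).
Proof. by move=> t; exact: is_derive_continuous (is_derive_mon _ _ _ _). Qed.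

Lemma continuous_weval x j gs : continuous (fun s => weval (update x j s) gs).
Proof. by move=> t; exact: is_derive_continuous (is_derive_weval _ _ _ _). Qed.

Lemma continuous_wpartial x j gs :
  continuous (fun s => wpartial j (update x j s) gs).
Proof.
rewrite /wpartial; elim: gs => [|w gs IH] t.
  by under eq_fun do rewrite big_nil; exact: cvg_cst.
under eq_fun do rewrite big_cons.
apply: cvgD; last exact: IH.
by apply: cvgM; [exact: cvg_cst|exact: continuous_mon].
Qed.

(** A product is at most a power of its largest factor; [z ^+ k] carries the running maximum through
    the induction. Integrability of words thus reduces to moments of single inputs. *)
Lemma prod_le_sumX (y : nat -> R) w (z : R) k : 0 <= z -> (forall l, 0 <= y l) ->
  (\prod_(l <- w) y l) * z ^+ k <=
  \sum_(l <- w) y l ^+ (k + size w) + z ^+ (k + size w).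
Proof.
move=> + y0; elim: w z k => [|a w IH] z k z0.
  by rewrite !big_nil addn0 mul1r add0r.
rewrite !big_cons /= addnS -addSn.
have hp : 0 <= \prod_(l <- w) y l by apply: prodr_ge0.
have [az|za] := leP (y a) z.
  apply: (@le_trans _ _ ((\prod_(l <- w) y l) * z ^+ k.+1)).
    rewrite exprS mulrA [y a * _]mulrC -!mulrA ler_wpM2l// ler_wpM2r//.
    exact: exprn_ge0.
  apply: (le_trans (IH _ _ z0)).
  by rewrite -addrA lerDr exprn_ge0.
apply: (@le_trans _ _ ((\prod_(l <- w) y l) * y a ^+ k.+1)).
  rewrite exprS mulrA [y a * _]mulrC -!mulrA !ler_wpM2l//.
  by rewrite lerXn2r// ?nnegrE// ltW.
apply: (le_trans (IH _ _ (y0 a))).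
by rewrite addrC lerDl exprn_ge0.
Qed.

Lemma mon_norm_le x w : `|mon x w| <= \sum_(l <- w) `|x l| ^+ size w + 1.
Proof.
have := @prod_le_sumX (fun l => `|x l|) w 1 0 ler01 (fun l => normr_ge0 _).
by rewrite expr0 mulr1 add0n expr1n /mon normr_prod.
Qed.

End Words.

(** * Integration by parts in the first letter of a word *)

Section MultiIBP.
Context {R : realType} {d} {T : measurableType d} (P : probability T R).
Variable (X : nat -> {RV P >-> R}).
Hypothesis hX : gaussian_input P X.
Implicit Types (w v : seq nat) (gs : seq (seq nat)).

Local Notation env w := (fun i => X i w).
Local Notation "''E' f" := (Rintegral P setT f) (at level 10, f at level 8).

Lemma measurable_mon w : measurable_fun setT (fun z => mon (env z) w).
Proof.
elim: w => [|a w IH].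
  by under eq_fun do rewrite mon_nil; exact: measurable_cst.
by under eq_fun do rewrite mon_cons; apply: measurable_funM.
Qed.

Lemma integrable_mon w : P.-integrable setT (fun z => (mon (env z) w)%:E).
Proof.
apply: (@le_integrable _ _ _ P setT measurableT _
  (fun z => (\sum_(l <- w) `|X l z| ^+ size w + 1)%:E)) => //.
- by apply/measurable_EFinP; exact: measurable_mon.
- move=> z _; rewrite lee_fin; apply: le_trans (ler_norm _).
  exact: mon_norm_le.
- rewrite (_ : (fun z => _) = (fun z => (\sum_(l <- w) (`|X l z| ^+ size w)%:E) + 1%:E)%E); last first.
    by apply/funext => z; rewrite EFinD sumEFin.
  apply: integrableD => //; last exact: finite_measure_integrable_cst.
  apply: integrable_sum => // l _.
  apply: (@gaussian_integrable _ _ _ P (X l) _ (fun x => `|x| ^+ size w)).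
  + by have [_] := hX; exact.
  + by apply: measurable_funX; exact: normr_measurable.
  + by apply: subgaussX; apply: subgauss_norm; exact: subgauss_id.
Qed.

Lemma integrable_mon_lipschitz K phi dphi w gs : lipschitz_deriv K phi dphi ->
  P.-integrable setT (fun z => (mon (env z) w * phi (weval (env z) gs))%:E).
Proof.
move=> hphi.
have cphi : continuous phi.
  by have [h _ _] := hphi; move=> x; exact: is_derive_continuous (h x).
have mw : measurable_fun setT (fun z => weval (env z) gs).
  by apply: measurable_sum => ?; exact: measurable_mon.
apply: (@le_integrable _ _ _ P setT measurableT _
  (fun z => (`|phi 0| * `|mon (env z) w|
    + K * \sum_(v <- gs) `|mon (env z) (w ++ v)|)%:E)) => //.
- apply/measurable_EFinP; apply: measurable_funM; first exact: measurable_mon.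
  by apply: measurableT_comp => //; exact: continuous_measurable_fun.
- move=> z _; rewrite lee_fin; apply: le_trans (ler_norm _).
  rewrite normrM.
  have K0 : 0 <= K.
    by have [_ _ /(_ 0)] := hphi; apply: le_trans.
  apply: (le_trans (ler_wpM2l (normr_ge0 _) (lipschitz_deriv_growth _ hphi))).
  rewrite mulrDr mulrC lerD2l mulrCA ler_wpM2l//.
  under eq_bigr do rewrite mon_cat normrM.
  by rewrite -mulr_sumr ler_wpM2l// ler_norm_sum.
- rewrite (_ : (fun z => _) = (fun z => (`|phi 0|%:E * `|(mon (env z) w)%:E|) +
      (K%:E * \sum_(v <- gs) `|(mon (env z) (w ++ v))%:E|))%E); last first.
    by apply/funext => z; rewrite EFinD !EFinM sumEFin.
  apply: integrableD => //; apply: integrableZl => //.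
    exact: integrable_abse (integrable_mon _).
  apply: integrable_sum => // v _.
  exact: integrable_abse (integrable_mon _).
Qed.

Let T' j := g_sigma_algebraType (cylinders X j).

(** At [j] the first component is read, and elsewhere only inputs other than [X j], which are
    measurable for the coarser sigma-algebra. *)
Lemma measurable_update j l :
  measurable_fun setT (fun z : R * T' j => update (env z.2) j z.1 l).
Proof.
rewrite /update; case: eqVneq => [_|lj]; first exact: measurable_fst.
apply: (measurableT_comp (f := (X l : T' j -> R))); last exact: measurable_snd.
exact: measurable_cylinder_coord.
Qed.

Lemma measurable_mon_update j w :
  measurable_fun setT (fun z : R * T' j => mon (update (env z.2) j z.1) w).
Proof.
elim: w => [|a w IH].
  by under eq_fun do rewrite mon_nil; exact: measurable_cst.
under eq_fun do rewrite mon_cons; apply: measurable_funM => //.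
exact: measurable_update.
Qed.

Lemma update_env j z : update (env z) j (X j z) = env z.
Proof. by apply/funext => i; rewrite /update; case: eqP => // ->. Qed.

Lemma integrable_word_lipschitz (K : R) phi dphi w gs (c : R) : lipschitz_deriv K phi dphi ->
  P.-integrable setT (fun z => (c * (mon (env z) w * phi (weval (env z) gs)))%:E).
Proof.
move=> h; under eq_fun do rewrite EFinM.
exact: integrableZl (integrable_mon_lipschitz w gs h).
Qed.

Lemma integrable_word_wpartial K phi dphi j w gs : lipschitz_deriv K phi dphi ->
  P.-integrable setT (fun z => (mon (env z) w * (wpartial j (env z) gs *
    dphi (weval (env z) gs)))%:E).
Proof.
move=> [hd cd bd].
have mdphi : measurable_fun setT (fun z => dphi (weval (env z) gs)).
  apply: measurableT_comp; first exact: continuous_measurable_fun.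
  by apply: measurable_sum => ?; exact: measurable_mon.
have mwp : measurable_fun setT (fun z => wpartial j (env z) gs).
  by apply: measurable_sum => ?; apply: measurable_funM => //; exact: measurable_mon.
apply: (@le_integrable _ _ _ P setT measurableT _
  (fun z => (K * \sum_(v <- gs) (count_mem j v)%:R * `|mon (env z) (w ++ rem j v)|)%:E)) => //.
- apply/measurable_EFinP; apply: measurable_funM; first exact: measurable_mon.
  exact: measurable_funM.
- move=> z _; rewrite lee_fin; apply: le_trans (ler_norm _).
  rewrite mulrA normrM mulrC.
  apply: ler_pM => //.
  rewrite normrM /wpartial.
  apply: (le_trans (ler_wpM2l (normr_ge0 _) (ler_norm_sum _ _ _))).
  rewrite mulr_sumr ler_sum// => v _.
  by rewrite mon_cat !normrM normr_nat mulrCA.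
- rewrite (_ : (fun z => _) = (fun z => K%:E * \sum_(v <- gs)
      ((count_mem j v)%:R%:E * `|(mon (env z) (w ++ rem j v))%:E|))%E); last first.
    by apply/funext => z; rewrite EFinM -sumEFin.
  apply: integrableZl => //.
  apply: integrable_sum => // v _; apply: integrableZl => //.
  exact: integrable_abse (integrable_mon _).
Qed.

Lemma multi_ibp K phi dphi j v gs : lipschitz_deriv K phi dphi ->
  'E (fun z => mon (env z) (j :: v) * phi (weval (env z) gs)) =
  (count_mem j v)%:R * 'E (fun z => mon (env z) (rem j v) * phi (weval (env z) gs)) +
  'E (fun z => mon (env z) v * (wpartial j (env z) gs * dphi (weval (env z) gs))).
Proof.
move=> hphi; have [hd cd bd] := hphi.
have cphi : continuous phi by move=> x; exact: is_derive_continuous (hd x).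
(* [update] overwrites the input [j], so that [F t] and [dF t] depend on [z] through the other
   inputs alone. *)
pose F t z := mon (update (env z) j t) v * phi (weval (update (env z) j t) gs).
pose dF t z := (count_mem j v)%:R *
  (mon (update (env z) j t) (rem j v) * phi (weval (update (env z) j t) gs)) +
  mon (update (env z) j t) v * (wpartial j (update (env z) j t) gs *
    dphi (weval (update (env z) j t) gs)).
have i1 := integrable_word_lipschitz (rem j v) gs (count_mem j v)%:R hphi.
have i2 := integrable_word_wpartial j v gs hphi.
have mphiw (f : R -> R) : continuous f ->
  measurable_fun setT (fun z : R * T' j => f (weval (update (env z.2) j z.1) gs)).
  move=> cf; apply: measurableT_comp; first exact: continuous_measurable_fun.
  by apply: measurable_sum => ?; exact: measurable_mon_update.
have gw z : subgauss (fun t => weval (update (env z) j t) gs).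
  by apply: subgauss_sum => ?; exact: subgauss_mon.
have h := @resample_ibp _ _ _ P X hX j F dF.
rewrite -RintegralZl//; last exact: integrable_mon_lipschitz hphi.
rewrite -RintegralD//.
rewrite /Rintegral; congr fine.
transitivity (\int[P]_z (X j z * F (X j z) z)%:E)%E.
  by apply: eq_integral => z _; rewrite /F update_env mon_cons mulrA.
transitivity (\int[P]_z (dF (X j z) z)%:E)%E; last first.
  by apply: eq_integral => z _; rewrite /dF update_env.
apply: h.
- move=> z t.
  have e1 := is_derive_mon (env z) j v t.
  have e2 := is_derive1_comp (hd _) (is_derive_weval (env z) j gs t).
  apply: (is_derive_eq (is_deriveM e1 e2)); rewrite /GRing.scale/= /dF.
  by ring.
- move=> z t; apply: cvgD; apply: cvgM.
  + exact: cvg_cst.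
  + apply: cvgM; first exact: continuous_mon.
    by apply: continuous_comp; [exact: continuous_weval|exact: cphi].
  + exact: continuous_mon.
  + apply: cvgM; first exact: continuous_wpartial.
    by apply: continuous_comp; [exact: continuous_weval|exact: cd].
- move=> z; apply: subgaussM; first exact: subgauss_mon.
  exact: subgauss_lipschitz_comp hphi (gw z).
- move=> z; apply: subgaussD; apply: subgaussM.
  + exact: subgauss_cst.
  + apply: subgaussM; first exact: subgauss_mon.
    exact: subgauss_lipschitz_comp hphi (gw z).
  + exact: subgauss_mon.
  + apply: subgaussM.
      by apply: subgauss_sum => ?; apply: subgaussM; [exact: subgauss_cst|exact: subgauss_mon].
    apply: (@subgauss_le _ _ (fun=> K)); last exact: subgauss_cst.
    by move=> t; apply: le_trans (bd _) (ler_norm _).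
- by apply: measurable_funM; [exact: measurable_mon_update|exact: mphiw].
- apply: measurable_funD; apply: measurable_funM => //.
  + by apply: measurable_funM; [exact: measurable_mon_update|exact: mphiw].
  + exact: measurable_mon_update.
  + apply: measurable_funM; last exact: mphiw.
    by apply: measurable_sum => ?; apply: measurable_funM => //; exact: measurable_mon_update.
- rewrite (_ : (fun z => _) = (fun z : T => (mon (env z) (j :: v) * phi (weval (env z) gs))%:E)).
    exact: integrable_mon_lipschitz hphi.
  by apply/funext => z; rewrite /F update_env mon_cons mulrA.
- rewrite (_ : (fun z => _) = (fun z : T =>
    ((count_mem j v)%:R * (mon (env z) (rem j v) * phi (weval (env z) gs)))%:E +
    (mon (env z) v * (wpartial j (env z) gs * dphi (weval (env z) gs)))%:E))%E.
    exact: integrableD.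
  by apply/funext => z; rewrite /dF update_env EFinD.
Qed.

End MultiIBP.

(** * Wick's formula and the Stein identity for sums of words *)

Section SteinIdentity.
Context {R : realType} {d} {T : measurableType d} (P : probability T R).
Variable (X : nat -> {RV P >-> R}).
Hypothesis hX : gaussian_input P X.
Implicit Types (w v : seq nat) (gs : seq (seq nat)).

Local Notation env z := (fun i => X i z).
Local Notation "''E' f" := (Rintegral P setT f) (at level 10, f at level 8).

Lemma weval_stein_kernel (x : nat -> R) gs : weval x (stein_kernel gs) =
  \sum_(w <- gs) \sum_(jv <- stein_field w) mon x jv.2 * wpartial jv.1 x gs.
Proof.
rewrite /weval /stein_kernel big_flatten_seq big_map; apply: eq_bigr => w _.
rewrite big_flatten_seq big_map; apply: eq_bigr => jv _.
rewrite big_flatten_seq big_map /wpartial mulr_sumr; apply: eq_bigr => w2 _.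
by rewrite big_nseq_const mon_cat mulr_natl mulrnAr.
Qed.

Lemma lipschitz_deriv_cst (c : R) : lipschitz_deriv 0 (fun=> c) (fun=> 0).
Proof.
split=> [x|x|x]; [exact: is_derive_cst|exact: cvg_cst|by rewrite normr0].
Qed.

Lemma lipschitz_deriv_id : lipschitz_deriv 1 (fun x : R => x) (fun=> 1).
Proof.
split=> [x|x|x]; [exact: is_derive_id|exact: cvg_cst|by rewrite normr1].
Qed.

Lemma Rintegral_sum (I : Type) (s : seq I) (f : I -> T -> R) :
  (forall i, P.-integrable setT (EFin \o f i)) ->
  'E (fun z => \sum_(i <- s) f i z) = \sum_(i <- s) 'E (f i).
Proof.
move=> hf; elim: s => [|i s IH].
  under eq_Rintegral do rewrite big_nil.
  by rewrite big_nil Rintegral_cst// mul0r.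
under eq_Rintegral do rewrite big_cons.
rewrite RintegralD//; first by rewrite big_cons IH.
rewrite (_ : EFin \o _ = (fun z => \sum_(k <- s) (EFin \o f k) z)%E).
  exact: integrable_sum.
by apply/funext => z /=; rewrite sumEFin.
Qed.

Lemma Rintegral_cst1 (c : R) : 'E (fun=> c) = c.
Proof. by rewrite Rintegral_cst//= probability_setT mulr1. Qed.

(** [multi_ibp] is iterated along the fuel: the partner terms recurse on [rem a w] until the empty
    word leaves the Wick mean times E phi, and the derivative terms accumulate into the field. *)
Lemma stein_word K phi dphi w gs n : lipschitz_deriv K phi dphi ->
  (size w <= n)%N ->
  'E (fun z => mon (env z) w * phi (weval (env z) gs)) =
  (wick_fuel n w)%:R * 'E (fun z => phi (weval (env z) gs)) +
  \sum_(jv <- stein_fuel n w) 'E (fun z => mon (env z) jv.2 *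
    (wpartial jv.1 (env z) gs * dphi (weval (env z) gs))).
Proof.
move=> hphi; elim: n w => [|n IH] [|a w] //= sw.
- rewrite big_nil mul1r addr0; apply: eq_Rintegral => z _.
  by rewrite mon_nil mul1r.
- rewrite big_nil mul1r addr0; apply: eq_Rintegral => z _.
  by rewrite mon_nil mul1r.
rewrite (multi_ibp hX _ _ _ hphi).
have [aw|aw] := boolP (a \in w); last first.
  by rewrite (count_memPn aw) !mul0r !add0r /= big_seq1.
rewrite IH; last first.
  rewrite size_rem// -ltnS; apply: leq_trans sw; rewrite ltnS.
  exact: leq_trans (leq_pred _) _.
rewrite big_cons big_flatten_seq big_nseq_const mulrDr natrM mulrA -addrA.
by congr (_ + _); rewrite addrC mulr_natl.
Qed.

(** For phi = 1 in [stein_word] all field terms vanish. *)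
Lemma wickE_fuel w n : (size w <= n)%N ->
  'E (fun z => mon (env z) w) = (wick_fuel n w)%:R.
Proof.
move=> wn; have := @stein_word 0 (fun=> 1) (fun=> 0) w [::] n (lipschitz_deriv_cst 1) wn.
rewrite Rintegral_cst1 mulr1 big1 => [|jv _]; last first.
  under eq_Rintegral do rewrite !mulr0.
  by rewrite Rintegral_cst1.
by rewrite addr0 => <-; apply: eq_Rintegral => z _; rewrite mulr1.
Qed.

Lemma wickE w : 'E (fun z => mon (env z) w) = (wick w)%:R.
Proof. exact: wickE_fuel. Qed.

Lemma integrable_weval gs : P.-integrable setT (fun z => (weval (env z) gs)%:E).
Proof.
rewrite (_ : (fun z => _) = (fun z => \sum_(w <- gs) (mon (env z) w)%:E)%E).
  by apply: integrable_sum => // w _; exact: integrable_mon.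
by apply/funext => z /=; rewrite sumEFin.
Qed.

Lemma expectation_weval gs :
  'E (fun z => weval (env z) gs) = \sum_(w <- gs) (wick w)%:R.
Proof.
rewrite Rintegral_sum; last by move=> w; exact: integrable_mon.
by under eq_bigr do rewrite wickE.
Qed.

Lemma stein_identity K phi dphi gs : lipschitz_deriv K phi dphi ->
  'E (fun z => (weval (env z) gs - 'E (fun z => weval (env z) gs)) *
    phi (weval (env z) gs)) =
  'E (fun z => weval (env z) (stein_kernel gs) * dphi (weval (env z) gs)).
Proof.
move=> hphi.
under eq_Rintegral do rewrite mulrBl.
rewrite RintegralB//; last 2 first.
- rewrite (_ : EFin \o _ = (fun z => \sum_(w <- gs) (mon (env z) w * phi (weval (env z) gs))%:E)%E).
    by apply: integrable_sum => // w _; exact: (integrable_mon_lipschitz hX w gs hphi).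
  by apply/funext => z /=; rewrite sumEFin /weval mulr_suml.
- rewrite /comp; under eq_fun do rewrite EFinM; apply: integrableZl => //.
  have := integrable_mon_lipschitz hX [::] gs hphi.
  by under eq_fun do rewrite mon_nil mul1r.
rewrite RintegralZl//; last first.
  have := integrable_mon_lipschitz hX [::] gs hphi.
  by under eq_fun do rewrite mon_nil mul1r.
rewrite [in X in X - _](_ : (fun z => _) = (fun z => \sum_(w <- gs) (mon (env z) w * phi (weval (env z) gs)))); last first.
  by apply/funext => z; rewrite /weval mulr_suml.
rewrite Rintegral_sum; last by move=> w; exact: (integrable_mon_lipschitz hX w gs hphi).
rewrite expectation_weval mulr_suml -sumrB.
rewrite (_ : (fun z => _ * dphi _) = (fun z => \sum_(w <- gs) \sum_(jv <- stein_field w)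
  mon (env z) jv.2 * (wpartial jv.1 (env z) gs * dphi (weval (env z) gs)))); last first.
  apply/funext => z; rewrite weval_stein_kernel mulr_suml; apply: eq_bigr => w _.
  by rewrite mulr_suml; apply: eq_bigr => jv _; rewrite mulrA.
rewrite Rintegral_sum; last first.
  move=> w; rewrite (_ : EFin \o _ = (fun z => \sum_(jv <- stein_field w)
     (mon (env z) jv.2 * (wpartial jv.1 (env z) gs * dphi (weval (env z) gs)))%:E)%E).
    by apply: integrable_sum => // jv _; exact: (integrable_word_wpartial hX jv.1 jv.2 gs hphi).
  by apply/funext => z /=; rewrite sumEFin.
apply: eq_bigr => w _.
rewrite Rintegral_sum; last first.
  by move=> jv; exact: (integrable_word_wpartial hX jv.1 jv.2 gs hphi).
(* For each word, the Wick term of [stein_word] cancels its share of E g times E phi(g). *)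
by rewrite (stein_word gs hphi (leqnn _)) addrAC subrr add0r.
Qed.

End SteinIdentity.

(** * Stein's method in total variation *)

Section SteinEquation.
Context {R : realType}.
Let mu := @lebesgue_measure R.
Local Notation pdf := (@normal_pdf R 0 1).

Lemma normal_pdf01_gt0 x : 0 < pdf x.
Proof. by rewrite pdfE mulr_gt0 ?expR_gt0// normal_peak_gt0// oner_neq0. Qed.

Lemma normal_pdf01N x : pdf (- x) = pdf x.
Proof. by rewrite !pdfE sqrrN. Qed.

Lemma cvg_normal_pdf01 : pdf x @[x --> +oo] --> (0 : R).
Proof.
apply/cvgrPdist_le => e e0.
have h := @subgauss_pdf_cvg0 R (fun=> 1) (fun n => n%:R) (fun n => erefl) (subgauss_cst 1).
move/cvgrPdist_le : h => /(_ e e0) [N _ hN].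
near=> x.
have xN : N%:R <= x by near: x; apply: nbhs_pinfty_ge; rewrite num_real.
apply: le_trans (hN N (leqnn N)).
rewrite !sub0r !normrN mul1r !ger0_norm ?normal_pdf_ge0// !pdfE.
rewrite ler_wpM2l ?normal_peak_ge0// ler_expR ler_pM2r// lerN2.
by rewrite lerXn2r ?nnegrE//; exact: le_trans xN.
Unshelve. all: by end_near. Qed.

Lemma integral_mul_pdf_tail (x : R) : 0 <= x ->
  (\int[mu]_(y in `[x, +oo[) (y * pdf y)%:E = (pdf x)%:E)%E.
Proof.
move=> x0.
have cp : continuous pdf by exact: continuous_normal_pdf.
have dp (y : R) : is_derive y 1 (fun t => - pdf t) (y * pdf y).
  apply: (is_derive_eq (is_deriveN (is_derive_pdf y))).
  by rewrite mulNr opprK.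
rewrite (@ge0_continuous_FTC2y _ (fun y => y * pdf y) (fun y => - pdf y) x 0).
- by rewrite sub0e EFinN oppeK.
- by move=> y xy; rewrite mulr_ge0 ?normal_pdf_ge0// (le_trans x0).
- apply: continuous_subspaceT => y; apply: cvgM; first exact: cvg_id.
  exact: cp.
- by rewrite -[X in _ --> X]oppr0; apply: cvgN; exact: cvg_normal_pdf01.
- by move=> y _; have [] := dp y.
- by apply: cvg_at_right_filter; exact: is_derive_continuous (dp x).
- by move=> y _; rewrite derive1E; exact: derive_val.
Qed.

(** On the tail x is at most y, and y times the density integrates exactly. *)
Lemma mills_ratio (x : R) : 0 <= x ->
  (x%:E * \int[mu]_(y in `[x, +oo[) (pdf y)%:E <= (pdf x)%:E)%E.
Proof.
move=> x0; rewrite -integral_mul_pdf_tail// -ge0_integralZl//; last 2 first.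
- by apply/measurable_EFinP; apply: measurable_funTS; exact: measurable_normal_pdf.
- by move=> y _; rewrite lee_fin normal_pdf_ge0.
apply: ge0_le_integral => //.
- by move=> y _; rewrite -EFinM lee_fin mulr_ge0 ?normal_pdf_ge0.
- apply: emeasurable_funM => //.
  by apply/measurable_EFinP; apply: measurable_funTS; exact: measurable_normal_pdf.
- apply/measurable_EFinP; apply: measurable_funTS; apply: measurable_funM => //.
  exact: measurable_normal_pdf.
- move=> y /=; rewrite in_itv/= andbT => xy.
  by rewrite lee_fin ler_wpM2r ?normal_pdf_ge0.
Qed.

Lemma mills_ratioN (x : R) : 0 <= x ->
  (x%:E * \int[mu]_(y in `]-oo, (- x)%R]) (pdf y)%:E <= (pdf x)%:E)%E.
Proof.
move=> x0; rewrite ge0_integration_by_substitutionNy.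
- under eq_integral do rewrite /= normal_pdf01N.
  exact: mills_ratio.
- by apply: continuous_subspaceT; exact: continuous_normal_pdf.
- by move=> y _; exact: normal_pdf_ge0.
Qed.

Section Solution.
Variable k : R -> R.
Hypothesis ck : continuous k.
Hypothesis k1 : forall x, `|k x| <= 1.
Hypothesis k0 : (\int[mu]_x (k x * pdf x)%:E = 0)%E.

(** With [pdf] as integrating factor, [stein_sol] solves f'(x) - x f(x) = k(x); [stein_dsol] is f'
    as the equation expresses it. *)
Definition stein_num x := (\int[mu]_(t in `]-oo, x]) (k t * pdf t))%R.
Definition stein_sol x := stein_num x / pdf x.
Definition stein_dsol x := k x + x * stein_sol x.

Let ckp : continuous (fun x => k x * pdf x).
Proof. by move=> x; apply: cvgM; [exact: ck|exact: continuous_normal_pdf]. Qed.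

Let ikp : mu.-integrable setT (EFin \o (fun x => k x * pdf x)).
Proof.
apply: subgauss_integrable; first exact: continuous_measurable_fun.
apply: (@subgauss_le _ _ (fun=> 1)); last exact: subgauss_cst.
by move=> x; rewrite normr1.
Qed.

Lemma is_derive_stein_num (x : R) : is_derive x 1 stein_num (k x * pdf x).
Proof.
have [|||h1 h2] := @continuous_FTC1 R (fun x => k x * pdf x) -oo%O x (x + 1) _ _ _ (@ckp x).
- by rewrite ltrDl.
- exact: integrableS ikp.
- by rewrite ltNyr.
by apply: DeriveDef; [exact: h1|rewrite -derive1E; exact: h2].
Qed.

Lemma is_derive_stein_sol (x : R) : is_derive x 1 stein_sol (stein_dsol x).
Proof.
have pn0 : pdf x != 0 by rewrite gt_eqF ?normal_pdf01_gt0.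
have h := is_deriveM (is_derive_stein_num x) (is_deriveV pn0 (is_derive_pdf x)).
apply: (is_derive_eq h); rewrite /GRing.scale/= /stein_dsol /stein_sol.
by field.
Qed.

(** For negative x the left Mills bound applies directly. For the others, [k0] replaces the integral
    up to x by minus the integral beyond x, which keeps the relevant tail short. *)
Lemma stein_num_le (x : R) : `|x * stein_num x| <= pdf x.
Proof.
have mi (A : set R) : measurable A -> mu.-integrable A (EFin \o (fun x => k x * pdf x)).
  by move=> mA; exact: integrableS ikp.
have ip (A : set R) : measurable A -> mu.-integrable A (fun x => (pdf x)%:E).
  move=> mA; apply: integrableS (integrable_normal_pdf _ _) => //.
have key (A : set R) : measurable A ->
    (`|(\int[mu]_(t in A) (k t * pdf t))%R|%:E <= \int[mu]_(t in A) (pdf t)%:E)%E.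
  move=> mA; apply: (@le_trans _ _ (\int[mu]_(t in A) `|(k t * pdf t)%:E|)%E).
    rewrite /Rintegral -abse_EFin fineK; last exact: integrable_fin_num (mi _ mA).
    by apply: le_abse_integral => //; exact: measurable_int (mi _ mA).
  apply: ge0_le_integral => //.
  - by apply: measurableT_comp => //; exact: measurable_int (mi _ mA).
  - exact: measurable_int (ip _ mA).
  - move=> y _; rewrite lee_fin normrM (ger0_norm (normal_pdf_ge0 _ _ _)).
    by rewrite ler_piMl ?normal_pdf_ge0.
rewrite normrM -lee_fin EFinM.
have [x0|x0] := leP 0 x; last first.
  have := mills_ratioN (ltW (_ : 0 < - x)); rewrite oppr_gt0 opprK => /(_ x0).
  rewrite normal_pdf01N ltr0_norm//; apply: le_trans.
  by apply: lee_wpmul2l; [rewrite lee_fin oppr_ge0 ltW|exact: key].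
apply: (@le_trans _ _ (x%:E * \int[mu]_(t in `[x, +oo[) (pdf t)%:E)%E); last exact: mills_ratio.
rewrite ger0_norm//; apply: lee_wpmul2l; first by rewrite lee_fin.
suff -> : stein_num x = - (\int[mu]_(t in `[x, +oo[) (k t * pdf t))%R.
  by rewrite normrN; exact: key.
apply/eqP; rewrite -addr_eq0; apply/eqP.
rewrite /stein_num [X in _ + X](_ : _ = (\int[mu]_(t in `]x, +oo[) (k t * pdf t))%R); last first.
  apply/esym/Rintegral_itv_obnd_cbnd.
  exact: mi.
rewrite -Rintegral_setU//; last 2 first.
- by apply: mi; exact: measurableU.
- apply/disj_setPS => y [] /=; rewrite !in_itv/= andbT => yx.
  by rewrite ltNge yx.
rewrite (_ : _ `|` _ = setT); last first.
  apply/seteqP; split => // y _ /=; rewrite !in_itv/= andbT.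
  by have [yx|xy] := leP (y : R) x; [left|right].
by rewrite /Rintegral k0.
Qed.

(** The constant is 1 from [k] plus 1 from [x * stein_sol x]. *)
Lemma stein_sol_lipschitz : lipschitz_deriv 2 stein_sol stein_dsol.
Proof.
split; first exact: is_derive_stein_sol.
- move=> x; apply: cvgD; first exact: ck.
  by apply: cvgM; [exact: cvg_id|exact: is_derive_continuous (is_derive_stein_sol x)].
- move=> x; apply: (le_trans (ler_normD _ _)).
  rewrite (_ : 2 = 1 + 1)//; apply: lerD => //.
  rewrite /stein_sol mulrA normrM normfV (gtr0_norm (normal_pdf01_gt0 x)).
  by rewrite ler_pdivrMr ?normal_pdf01_gt0// mul1r stein_num_le.
Qed.

End Solution.
End SteinEquation.

(** * Continuous approximation of Borel indicators under two laws *)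

Section BoundedApproximation.
Context {R : realType} {d} {T : measurableType d} (P : probability T R).
Variables U V : {RV P >-> R}.
Local Notation "''E' f" := (Rintegral P setT f) (at level 10, f at level 8).

Lemma bounded_integrable (f : T -> R) (c : R) : measurable_fun setT f ->
  (forall z, `|f z| <= c) -> P.-integrable setT (EFin \o f).
Proof.
move=> mf fc; apply: measurable_bounded_integrable => //.
  exact: le_lt_trans (probability_le1 _ measurableT) (ltry _).
exists c; split; first exact: num_real.
by move=> x cx z _; exact: le_trans (fc z) (ltW cx).
Qed.

(** Adding the errors under both variables forces a single continuous approximant to serve both
    laws. *)
Definition gap (f g : R -> R) z := `|f (U z) - g (U z)| + `|f (V z) - g (V z)|.

Definition unit_valued (f : R -> R) :=
  measurable_fun setT f /\ forall x, 0 <= f x <= 1.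

Lemma measurable_gap f g : unit_valued f -> unit_valued g ->
  measurable_fun setT (gap f g).
Proof.
move=> [mf _] [mg _].
by apply: measurable_funD; apply: measurableT_comp => //;
  apply: measurable_funB; apply: measurableT_comp.
Qed.

Lemma unit_dist_le (f g : R -> R) x : unit_valued f -> unit_valued g ->
  `|f x - g x| <= 1.
Proof.
move=> [_ /(_ x)/andP[f0 f1]] [_ /(_ x)/andP[g0 g1]].
by rewrite ler_norml; apply/andP; split; lra.
Qed.

Lemma gap_le f g z : unit_valued f -> unit_valued g -> `|gap f g z| <= 2.
Proof.
move=> hf hg; rewrite /gap ger0_norm ?addr_ge0//.
by rewrite (_ : 2 = 1 + 1)//; apply: lerD; exact: unit_dist_le.
Qed.

Lemma integrable_gap f g : unit_valued f -> unit_valued g ->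
  P.-integrable setT (EFin \o gap f g).
Proof.
move=> hf hg; apply: (@bounded_integrable _ 2); first exact: measurable_gap.
by move=> z; exact: gap_le.
Qed.

Lemma gap_triangle f g h : unit_valued f -> unit_valued g -> unit_valued h ->
  'E (gap f h) <= 'E (gap f g) + 'E (gap g h).
Proof.
move=> hf hg hh; rewrite -RintegralD//; try exact: integrable_gap.
apply: le_Rintegral => //; first exact: integrable_gap.
  rewrite (_ : EFin \o _ = (EFin \o gap f g) \+ (EFin \o gap g h))%E//.
  by apply: integrableD => //; exact: integrable_gap.
move=> z _; rewrite /gap addrACA; apply: lerD; exact: ler_distD.
Qed.

Lemma gap_cvg (f_ : nat -> R -> R) f e : 0 < e -> (forall n, unit_valued (f_ n)) ->
  unit_valued f -> (forall x, f_ n x @[n --> \oo] --> f x) ->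
  exists n, 'E (gap (f_ n) f) <= e.
Proof.
move=> e0 hf_ hf cf.
have m_ n := measurable_int _ (integrable_gap (hf_ n) hf).
have i2 : P.-integrable setT (fun=> 2%:E : \bar R).
  exact: finite_measure_integrable_cst.
have c_ : {ae P, forall z, setT z -> (gap (f_ n) f z)%:E @[n --> \oo] --> 0%E}.
  apply: aeW => z _; apply: cvg_EFin; first by near=> n.
  rewrite /comp /= /gap -[X in _ --> X](addr0 0).
  have cz y : `|f_ n y - f y| @[n --> \oo] --> 0.
    by apply/norm_cvg0P; rewrite -(subrr (f y)); exact: cvgB (cf y) (cvg_cst _).
  by apply: cvgD; exact: cz.
have b_ : {ae P, forall z n, setT z -> `|(gap (f_ n) f z)%:E| <= 2%:E}%E.
  by apply: aeW => z n _; rewrite lee_fin; exact: gap_le.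
have [_ _ h] := dominated_convergence measurableT m_ (measurable_cst _) c_ i2 b_.
rewrite integral0 in h.
have /fine_cvgP[_ /cvgrPdist_le/(_ e e0) [N _ hN]] := h.
exists N; have := hN N (leqnn N).
rewrite sub0r normrN; exact: le_trans (ler_norm _).
Unshelve. all: by end_near. Qed.

Definition approximable f := forall e, 0 < e -> exists h,
  [/\ unit_valued h, continuous h & 'E (gap h f) <= e].

Lemma approximable_continuous f : unit_valued f -> continuous f -> approximable f.
Proof.
move=> hf cf e e0; exists f; split => //.
rewrite /gap; under eq_Rintegral do rewrite !subrr normr0 addr0.
by rewrite Rintegral_cst1 ltW.
Qed.

Lemma approximable_lim (f_ : nat -> R -> R) f : (forall n, unit_valued (f_ n)) ->
  (forall n, approximable (f_ n)) ->
  unit_valued f -> (forall x, f_ n x @[n --> \oo] --> f x) -> approximable f.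
Proof.
move=> hf_ af hf cf e e0; have e2 : 0 < e / 2 by rewrite divr_gt0.
have [n hn] := gap_cvg e2 hf_ hf cf.
have [h [uh ch he]] := af n _ e2.
exists h; split => //; rewrite (splitr e).
by apply: le_trans (gap_triangle uh (hf_ n) hf) _; exact: lerD.
Qed.

Lemma unit_indic (B : set R) : measurable B -> unit_valued (\1_B : R -> R).
Proof.
move=> mB; split; first exact: measurable_indic.
by move=> x; rewrite indicE; case: (_ \in _); rewrite ?lexx ?ler01.
Qed.

Definition approximable_sets : set (set R) :=
  [set B | measurable B /\ approximable (\1_B)].

Lemma max0B_dist (a b c e : R) :
  `|Num.max 0 (a - b) - Num.max 0 (c - e)| <= `|a - c| + `|b - e|.
Proof.
have h1 := ler_norm (a - c); have h2 := ler_norm (b - e).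
have h3 := ler_norm (- (a - c)); have h4 := ler_norm (- (b - e)).
rewrite !normrN in h3 h4.
rewrite ler_norml; apply/andP; split;
  case: (ltP 0 (a - b)); case: (ltP 0 (c - e)); lra.
Qed.

(** The positive part of [hA - hB] keeps values in [0, 1], and its error is at most the sum of the
    two errors by [max0B_dist]. *)
Lemma approximable_setD A B : B `<=` A -> approximable_sets A ->
  approximable_sets B -> approximable_sets (A `\` B).
Proof.
move=> BA [mA aA] [mB aB]; split; first exact: measurableD.
move=> e e0; have e2 : 0 < e / 2 by rewrite divr_gt0.
have [hA [uA cA heA]] := aA _ e2; have [hB [uB cB heB]] := aB _ e2.
have ch : continuous (fun x => Num.max 0 (hA x - hB x)).
  move=> x; apply: (@continuous_max _ _ (cst 0) (fun x => hA x - hB x)).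
    exact: cvg_cst.
  by apply: cvgB; [exact: cA|exact: cB].
have uh : unit_valued (fun x => Num.max 0 (hA x - hB x)).
  split; first exact: continuous_measurable_fun.
  move=> x; have [_ /(_ x)/andP[a0 a1]] := uA; have [_ /(_ x)/andP[b0 b1]] := uB.
  by case: (ltP 0 (hA x - hB x)) => ?; apply/andP; split; lra.
exists (fun x => Num.max 0 (hA x - hB x)); split => //.
have uiA := unit_indic mA; have uiB := unit_indic mB.
  apply: (@le_trans _ _ ('E (gap hA \1_A) + 'E (gap hB \1_B))).
    rewrite -RintegralD//; try exact: integrable_gap.
    apply: le_Rintegral => //.
    + apply: (@integrable_gap (fun x => Num.max 0 (hA x - hB x)) (\1_(A `\` B))) => //.
      by apply: unit_indic; exact: measurableD.
    + rewrite (_ : EFin \o _ = (EFin \o gap hA \1_A) \+ (EFin \o gap hB \1_B))%E//.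
      by apply: integrableD => //; exact: integrable_gap.
    + move=> z _; rewrite /gap addrACA.
      have e1 x : \1_(A `\` B) x = Num.max 0 (\1_A x - \1_B x) :> R.
        rewrite !indicE in_setD.
        have [xB|xB] := boolP (x \in B); have [xA|xA] := boolP (x \in A) => /=.
        * by rewrite subrr maxxx.
        * by exfalso; move: xB xA; rewrite inE notin_setE => /BA.
        * by rewrite subr0; apply/esym/max_r; exact: ler01.
        * by rewrite subr0 maxxx.
      rewrite !e1; apply: lerD; exact: max0B_dist.
  by rewrite (splitr e); exact: lerD.
Qed.

Lemma approximable_ray (a : R) : approximable_sets `]a, +oo[%classic.
Proof.
split; first exact: measurable_itv.
pose f_ (n : nat) x := Num.min 1 (Num.max 0 (n%:R * (x - a))).
have cf n : continuous (f_ n).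
  move=> x; apply: (@continuous_min _ _ (cst 1) (fun x => Num.max 0 (n%:R * (x - a)))).
    exact: cvg_cst.
  apply: (@continuous_max _ _ (cst 0) (fun x => n%:R * (x - a))).
    exact: cvg_cst.
  by apply: cvgM; [exact: cvg_cst|apply: cvgB; [exact: cvg_id|exact: cvg_cst]].
have uf n : unit_valued (f_ n).
  split; first exact: continuous_measurable_fun.
  move=> x; rewrite /f_ le_min ler01 le_max lexx /=.
  by rewrite ge_min lexx.
apply: (@approximable_lim f_) => //.
- by move=> n; exact: approximable_continuous.
- by apply: unit_indic; exact: measurable_itv.
- move=> x; rewrite indicE mem_setE /= in_itv/= andbT.
  have [ax|xa] := ltP a x.
    apply: cvg_near_cst; near=> n.
    rewrite /f_; apply/min_l; rewrite le_max; apply/orP; right.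
    rewrite -ler_pdivrMr ?subr_gt0//.
    by near: n; exact: nbhs_infty_ger.
  apply: cvg_near_cst; near=> n.
  rewrite /f_ max_l; first by rewrite min_r.
  by rewrite mulr_ge0_le0// subr_le0.
Unshelve. all: by end_near. Qed.

(** Pi-lambda argument: the rays, limits of continuous ramps, are stable under intersection and
    generate the Borel sets; the approximable sets form a lambda-system. *)
Lemma approximable_measurable (B : set R) : measurable B -> approximable_sets B.
Proof.
move=> mB.
have GI : setI_closed (@RGenOInfty.G R).
  move=> _ _ [x ->] [y ->]; exists (Num.max x y).
  by apply/seteqP; split => z /=; rewrite !in_itv/= !andbT gt_max; [move=> [-> ->]|move/andP].
have lam : lambda_system setT approximable_sets.
  split => //.
  - split => //; apply: approximable_continuous.
      by apply: unit_indic.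
    by rewrite indicT; exact: cst_continuous.
  - by move=> A C CA aA aC; exact: approximable_setD.
  - move=> F ndF hF; have mF : measurable (\bigcup_n F n).
      by apply: bigcup_measurable => n _; have [] := hF n.
    split => //.
    apply: (@approximable_lim (fun n => \1_(F n))).
    + by move=> n; apply: unit_indic; have [] := hF n.
    + by move=> n; have [] := hF n.
    + exact: unit_indic.
    + move=> x; rewrite indicE.
      have [|xF] := boolP (x \in _).
        rewrite inE => -[N _ FN]; apply: cvg_near_cst; near=> n.
        rewrite indicE mem_set//; move: FN; apply/subsetPset/ndF.
        by near: n; exact: nbhs_infty_ge.
      apply: cvg_near_cst; near=> n; rewrite indicE memNset// => Fx.
      by move: xF; rewrite notin_setE; apply; exists n.
have := @lambda_system_subset R (@RGenOInfty.G R) GI setT approximable_sets lam.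
apply=> //; first by move=> _ [x ->]; exact: approximable_ray.
have : (@RGenOInfty.G R).-sigma.-measurable B by rewrite -RGenOInfty.measurableE; exact: mB.
by [].
Unshelve. all: by end_near. Qed.

Lemma prob_preimage_approx (B : set R) (c : R) : measurable B ->
  (forall h, unit_valued h -> continuous h ->
    `|'E (fun z => h (U z)) - 'E (fun z => h (V z))| <= c) ->
  (`|distribution P U B - distribution P V B| <= c%:E)%E.
Proof.
move=> mB hc.
have [_ aB] := approximable_measurable mB.
have uB := unit_indic mB.
have iE (W : {RV P >-> R}) : distribution P W B = ('E (fun z => \1_B (W z)))%:E.
  rewrite /distribution /pushforward -[in LHS](setIT (W @^-1` B)).
  rewrite -integral_indic//; last first.
    by rewrite -[X in measurable X]setTI; apply: measurable_funPT.
  rewrite /Rintegral fineK//.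
  apply: integrable_fin_num => //.
  apply: (@bounded_integrable _ 1); first exact: measurableT_comp.
  by move=> z; rewrite indicE; case: (_ \in _); rewrite ?normr1 ?normr0.
rewrite !iE -EFinB /= lee_fin.
apply/ler_addgt0Pr => e e0; have [h [uh ch he]] := aB _ e0.
have ib f (W : {RV P >-> R}) : unit_valued f -> P.-integrable setT (EFin \o (fun z => f (W z))).
  move=> [mf f01]; apply: (@bounded_integrable _ 1); first exact: measurableT_comp.
  by move=> z; rewrite ger0_norm; have /andP[] := f01 (W z).
have id f g (W : {RV P >-> R}) : unit_valued f -> unit_valued g ->
    P.-integrable setT (EFin \o (fun z => f (W z) - g (W z))).
  move=> uf ug; rewrite (_ : EFin \o _ = (EFin \o (fun z => f (W z))) \- (EFin \o (fun z => g (W z))))%E//.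
  by apply: integrableB => //; exact: ib.
have hd (W : {RV P >-> R}) : `|'E (fun z => h (W z)) - 'E (fun z => \1_B (W z))| <=
    'E (fun z => `|h (W z) - \1_B (W z)|).
  rewrite -RintegralB//; try exact: ib.
  by apply: le_normr_Rintegral => //; exact: id.
have ga : 'E (gap h \1_B) = 'E (fun z => `|h (U z) - \1_B (U z)|) + 'E (fun z => `|h (V z) - \1_B (V z)|).
  rewrite RintegralD//; apply: (integrable_norm (f := fun z => _ - _)); exact: id.
have hU := hd U; have hV := hd V; have hUV := hc h uh ch.
move: hU hV hUV he; rewrite ga.
set a := 'E (fun z => h (U z)); set b := 'E (fun z => h (V z)).
set a' := 'E (fun z => \1_B (U z)); set b' := 'E (fun z => \1_B (V z)).
move=> hU hV hUV he.
rewrite (_ : a' - b' = (a - b) - (a - a') + (b - b')); last by ring.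
apply: (le_trans (ler_normD _ _)); apply: (le_trans (lerD (ler_normB _ _) (lexx _))).
lra.
Qed.

End BoundedApproximation.

(** * From the Stein kernel to a total variation bound *)

Section SteinTV.
Context {R : realType} {d} {T : measurableType d} (P : probability T R).
Variable (X : nat -> {RV P >-> R}).
Hypothesis hX : gaussian_input P X.
Local Notation env z := (fun i => X i z).
Local Notation "''E' f" := (Rintegral P setT f) (at level 10, f at level 8).

Lemma weval_mul (x : nat -> R) gs hs :
  weval x gs * weval x hs = weval x [seq w ++ v | w <- gs, v <- hs].
Proof.
rewrite /weval big_allpairs_dep mulr_suml; apply: eq_bigr => w _.
by rewrite mulr_sumr; apply: eq_bigr => v _; rewrite mon_cat.
Qed.

Lemma lipschitz_deriv_affine (K m s : R) psi dpsi : 0 < s ->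
  lipschitz_deriv K psi dpsi ->
  lipschitz_deriv (K / s) (fun y => psi ((y - m) / s)) (fun y => dpsi ((y - m) / s) / s).
Proof.
move=> s0 [hd cd bd].
have da (x : R) : is_derive x 1 (fun y : R => (y - m) / s) s^-1.
  rewrite (_ : (fun y : R => _) = cst s^-1 * (id - cst m)); last first.
    by apply/funext => y; rewrite !fctE mulrC.
  by apply: is_derive_eq; rewrite /GRing.scale/= subr0 mulr1 mulr0 addr0.
split.
- by move=> x; exact: (is_derive1_comp (hd _) (da x)).
- move=> x; apply: cvgM; last exact: cvg_cst.
  by apply: continuous_comp; [exact: is_derive_continuous (da x)|exact: cd].
- by move=> x; rewrite normrM normfV (gtr0_norm s0) ler_pM2r// invr_gt0.
Qed.

Lemma integrable_weval_sqr (c e : R) gs :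
  P.-integrable setT (EFin \o (fun z => (c - weval (env z) gs * e) ^+ 2)).
Proof.
rewrite (_ : EFin \o _ = (fun z => (c ^+ 2)%:E + ((- (2 * c * e))%:E * (weval (env z) gs)%:E
  + (e ^+ 2)%:E * (weval (env z) [seq w ++ v | w <- gs, v <- gs])%:E))%E); last first.
  by apply/funext => z /=; rewrite -weval_mul -!EFinM -!EFinD; congr EFin; ring.
apply: integrableD => //; first exact: finite_measure_integrable_cst.
by apply: integrableD => //; apply: integrableZl => //; exact: integrable_weval.
Qed.

Lemma stein_tv gs (m s delta : R) (W : {RV P >-> R}) :
  m = 'E (fun z => weval (env z) gs) -> 0 < s -> 0 < delta ->
  (forall z, W z = (weval (env z) gs - m) / s) ->
  'E (fun z => (1 - weval (env z) (stein_kernel gs) * (s ^+ 2)^-1) ^+ 2) <= delta ^+ 2 ->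
  forall B : set R, measurable B ->
  (`|distribution P W B - normal_prob 0 1 B| <= (2 * delta)%:E)%E.
Proof.
move=> mE s0 d0 WE hdelta B mB.
(* The comparison of laws requires two variables on one space; [X 0] realises the standard
   normal. *)
have hX0 : forall C : set R, measurable C -> distribution P (X 0) C = normal_prob 0 1 C.
  by have [_] := hX; exact.
rewrite -hX0//; apply: prob_preimage_approx => // h uh ch.
have ib f (V : {RV P >-> R}) c : continuous f -> (forall x, `|f x| <= c) ->
    P.-integrable setT (EFin \o (fun z => f (V z))).
  move=> cf f01; apply: (@bounded_integrable _ _ _ _ _ c) => //.
  by apply: measurableT_comp => //; exact: continuous_measurable_fun.
have h1 x : `|h x| <= 1.
  by have [_ /(_ x) /andP[a0 a1]] := uh; rewrite ger0_norm.
set mh := 'E (fun z => h (X 0 z)).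
have mh01 : 0 <= mh <= 1.
  apply/andP; split.
    by apply: Rintegral_ge0 => z _; have [_ /(_ (X 0 z)) /andP[]] := uh.
  rewrite -[leRHS](Rintegral_cst1 P); apply: le_Rintegral => //; first exact: (ib h _ 1).
    exact: finite_measure_integrable_cst.
  by move=> z _; have [_ /(_ (X 0 z)) /andP[]] := uh.
pose k x := h x - mh.
have ck : continuous k by move=> x; apply: cvgB; [exact: ch|exact: cvg_cst].
have k1 x : `|k x| <= 1.
  have [_ /(_ x) /andP[a0 a1]] := uh; case/andP: mh01 => b0 b1.
  by rewrite /k ler_norml; apply/andP; split; lra.
have sk : subgauss k.
  apply: (@subgauss_le _ _ (fun=> 1)); last exact: subgauss_cst.
  by move=> x; rewrite normr1.
have mk : measurable_fun setT k by exact: continuous_measurable_fun.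
have k0 : (\int[lebesgue_measure]_x (k x * normal_pdf 0 1 x)%:E = 0)%E.
  rewrite -(integral_gaussian hX0 mk sk).
  rewrite (@integral_distribution _ _ _ _ _ P (X 0) (EFin \o k))//; last 2 first.
  - exact/measurable_EFinP.
  - exact: (ib k _ 1).
  have e0 : 'E (fun z => k (X 0 z)) = 0.
    rewrite RintegralB//; [|exact: (ib h _ 1)|exact: finite_measure_integrable_cst].
    by rewrite Rintegral_cst1 subrr.
  rewrite -[LHS]fineK; first by congr EFin; exact: e0.
  by apply: integrable_fin_num => //; exact: (ib k _ 1).
have hpsi := stein_sol_lipschitz ck k1 k0.
set psi := stein_sol k in hpsi; set dpsi := stein_dsol k in hpsi.
have [_ cdpsi bdpsi] := hpsi.
have hphi := lipschitz_deriv_affine m s0 hpsi.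
have SI := stein_identity hX gs hphi.
rewrite -mE in SI.
have idp : P.-integrable setT (EFin \o (fun z => dpsi (W z))) by exact: (ib dpsi _ 2).
pose Y z := 1 - weval (env z) (stein_kernel gs) * (s ^+ 2)^-1.
have iY2 : P.-integrable setT (EFin \o (fun z => Y z ^+ 2)) by exact: integrable_weval_sqr.
have mwv hs : measurable_fun setT (fun z => weval (env z) hs).
  by apply: measurable_sum => w; exact: measurable_mon.
have iGd : P.-integrable setT (EFin \o (fun z => weval (env z) (stein_kernel gs) * dpsi (W z))).
  apply: (@le_integrable _ _ _ P setT measurableT _
    (fun z => 2%:E * (weval (env z) (stein_kernel gs))%:E)%E) => //.
  - apply/measurable_EFinP; apply: measurable_funM => //.
    by apply: measurableT_comp => //; exact: continuous_measurable_fun.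
  - move=> z _; rewrite /= lee_fin !normrM mulrC (ger0_norm (ler0n _ 2)).
    exact: ler_wpM2r.
  - by apply: integrableZl => //; exact: integrable_weval.
(* Stein's equation writes h(W) - mh as psi'(W) - W psi(W). The identity [SI] turns the mean of the
   last term into E[Gamma psi'(W)] / s^2, one 1/s coming from standardisation and the other from the
   chain rule. *)
have key : 'E (fun z => h (W z)) - mh = 'E (fun z => dpsi (W z) * Y z).
  transitivity ('E (fun z => k (W z))).
    rewrite RintegralB//; [|exact: (ib h _ 1)|exact: finite_measure_integrable_cst].
    by rewrite Rintegral_cst1.
  transitivity ('E (fun z => dpsi (W z) - s^-1 * ((weval (env z) gs - m) * psi ((weval (env z) gs - m) / s)))).
    apply: eq_Rintegral => z _; rewrite /dpsi /stein_dsol -/psi WE.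
    by ring.
  have isW : P.-integrable setT (EFin \o (fun z => (weval (env z) gs - m) * psi ((weval (env z) gs - m) / s))).
    rewrite (_ : EFin \o _ = (fun z => \sum_(w <- gs) (mon (env z) w * psi ((weval (env z) gs - m) / s))%:E
       - m%:E * (mon (env z) [::] * psi ((weval (env z) gs - m) / s))%:E)%E); last first.
      apply/funext => z; rewrite /= sumEFin /=; congr EFin.
      by rewrite mon_nil mul1r mulrBl /weval mulr_suml.
    apply: integrableB => //.
      by apply: integrable_sum => // w _; exact: (integrable_mon_lipschitz hX w gs hphi).
    by apply: integrableZl => //; exact: (integrable_mon_lipschitz hX [::] gs hphi).
  rewrite RintegralB//; last first.
    by rewrite /comp; under eq_fun do rewrite EFinM; exact: integrableZl.
  rewrite RintegralZl// SI -RintegralZl//; last first.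
    rewrite (_ : EFin \o _ = (fun z => (s^-1)%:E * (weval (env z) (stein_kernel gs) * dpsi (W z))%:E)%E).
      exact: integrableZl.
    by apply/funext => z; rewrite -EFinM /= WE; congr EFin; ring.
  rewrite -RintegralB//; last first.
    rewrite (_ : EFin \o _ = (fun z => (s^-1 * s^-1)%:E * (weval (env z) (stein_kernel gs) * dpsi (W z))%:E)%E).
      exact: integrableZl.
    by apply/funext => z; rewrite -EFinM /= WE; congr EFin; ring.
  apply: eq_Rintegral => z _; rewrite /Y -WE expr2 invfM; ring.
rewrite key.
have idY : P.-integrable setT (EFin \o (fun z => dpsi (W z) * Y z)).
  rewrite (_ : EFin \o _ = (fun z => (dpsi (W z))%:E - ((s ^+ 2)^-1)%:E * (weval (env z) (stein_kernel gs) * dpsi (W z))%:E)%E).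
    by apply: integrableB => //; exact: integrableZl.
  by apply/funext => z; rewrite -EFinM -EFinB /= /Y; congr EFin; ring.
apply: (le_trans (le_normr_Rintegral measurableT idY)).
(* From |psi'| <= 2 and 2|Y| <= delta + Y^2 / delta, in place of Cauchy-Schwarz; [hdelta] makes the
   mean at most 2 delta. *)
apply: (@le_trans _ _ ('E (fun z => delta + delta^-1 * Y z ^+ 2))).
  apply: le_Rintegral => //.
  - by apply: (integrable_norm (f := fun z => _ * _)).
  - rewrite (_ : EFin \o _ = (fun z => delta%:E + (delta^-1)%:E * (Y z ^+ 2)%:E)%E)//.
    apply: integrableD => //; first exact: finite_measure_integrable_cst.
    exact: integrableZl.
  - move=> z _; rewrite normrM -real_normK ?num_real//.
    apply: (@le_trans _ _ (2 * `|Y z|)); first by rewrite ler_wpM2r.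
    set y := `|Y z|.
    have : 0 <= (delta - y) ^+ 2 / delta by rewrite divr_ge0 ?sqr_ge0// ltW.
    rewrite (_ : (delta - y) ^+ 2 / delta = delta + delta^-1 * y ^+ 2 - 2 * y); last first.
      by field; rewrite gt_eqF.
    by rewrite subr_ge0.
rewrite RintegralD//; last 2 first.
- exact: finite_measure_integrable_cst.
- by rewrite /comp; under eq_fun do rewrite EFinM; exact: integrableZl.
rewrite Rintegral_cst1 RintegralZl// (_ : 2 * delta = delta + delta^-1 * delta ^+ 2); last first.
  by field; rewrite gt_eqF.
by rewrite lerD2l ler_wpM2l// invr_ge0 ltW.
Qed.

End SteinTV.

(** * Traces of powers of patterned matrices *)

Section TracePaths.
Import GRing.Theory.
Local Open Scope ring_scope.
Variables (R : comNzRingType) (n : nat).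

(** A path from a to b with inner vertices f has m + 1 edges, the k-th running from [consf a f k] to
    [snocf f b k]. *)
Definition consf (T : Type) m (a : T) (f : 'I_m -> T) (k : 'I_m.+1) := oapp f a (unlift ord0 k).
Definition snocf (T : Type) m (f : 'I_m -> T) (b : T) (k : 'I_m.+1) := oapp f b (unlift ord_max k).

Lemma consf0 T m (a : T) (f : 'I_m -> T) : consf a f ord0 = a.
Proof. by rewrite /consf unlift_none. Qed.

Lemma consf_lift T m (a : T) (f : 'I_m -> T) k : consf a f (lift ord0 k) = f k.
Proof. by rewrite /consf liftK. Qed.

Lemma snocf_lift T m (b : T) (f : 'I_m -> T) k : snocf f b (lift ord_max k) = f k.
Proof. by rewrite /snocf liftK. Qed.

Lemma snocf_max T m (b : T) (f : 'I_m -> T) : snocf f b ord_max = b.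
Proof. by rewrite /snocf unlift_none. Qed.

Lemma sum_ffun_cons (V : nmodType) (T : finType) m (F : {ffun 'I_m.+1 -> T} -> V) :
  \sum_i F i = \sum_a \sum_(f : {ffun 'I_m -> T}) F (finfun (consf a f)).
Proof.
rewrite pair_bigA /= (reindex (fun af : T * {ffun 'I_m -> T} => finfun (consf af.1 af.2)))//=.
exists (fun i => (i ord0, [ffun k => i (lift ord0 k)])) => [[a f] _|i _] /=.
  by rewrite ffunE consf0; congr pair; apply/ffunP => k; rewrite !ffunE consf_lift.
apply/ffunP => k; rewrite ffunE; case: (unliftP ord0 k) => [k'|] ->.
  by rewrite consf_lift ffunE.
by rewrite consf0.
Qed.

Lemma snocf_consf T m (c b : T) (f : 'I_m -> T) k :
  snocf (consf c f) b (lift ord0 k) = snocf f b k.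
Proof.
case: (unliftP ord_max k) => [k'|] ->.
  rewrite snocf_lift (_ : lift ord0 _ = lift ord_max (lift ord0 k')).
    by rewrite snocf_lift consf_lift.
  by apply: val_inj; rewrite /= /bump; have := ltn_ord k'; lia.
by rewrite snocf_max (_ : lift ord0 _ = ord_max) ?snocf_max//; apply: val_inj.
Qed.

Lemma expmx_paths (A : 'M[R]_n) m a b : (A ^+ m.+1) a b =
  \sum_(f : {ffun 'I_m -> 'I_n}) \prod_(k < m.+1) A (consf a f k) (snocf f b k).
Proof.
elim: m a b => [|m IH] a b.
  rewrite expr1 (big_pred1 [ffun k : 'I_0 => a]).
    rewrite big_ord1 consf0 -[in LHS](snocf_max b [ffun k : 'I_0 => a]).
    by congr (A _ (snocf _ _ _)); apply: val_inj.
  by move=> f; apply/esym/eqP/ffunP => -[].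
rewrite exprS mxE sum_ffun_cons; apply: eq_bigr => c _.
rewrite IH mulr_sumr; apply: eq_bigr => f _.
rewrite [RHS]big_ord_recl consf0; congr (A _ _ * _).
  rewrite (_ : ord0 = lift ord_max ord0) ?snocf_lift ?ffunE ?consf0//.
  exact: val_inj.
apply: eq_bigr => k _; rewrite consf_lift ffunE; congr (A _ _).
rewrite -(snocf_consf c b f k); case: (unliftP ord_max (lift ord0 k)) => [k'|] ->.
  by rewrite !snocf_lift ffunE.
by rewrite !snocf_max.
Qed.

Lemma tr_expmx_paths (A : 'M[R]_n) m : \tr (A ^+ m.+1) =
  \sum_(i : {ffun 'I_m.+1 -> 'I_n}) \prod_k A (i k) (i (ordS k)).
Proof.
rewrite /mxtrace sum_ffun_cons; apply: eq_bigr => a _.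
rewrite expmx_paths; apply: eq_bigr => f _; apply: eq_bigr => k _.
rewrite !ffunE; congr (A _ _); case: (unliftP ord_max k) => [k'|] ->.
  rewrite snocf_lift (_ : ordS _ = lift ord0 k') ?consf_lift//.
  apply: val_inj; rewrite /= /bump; have := ltn_ord k' => h.
  by rewrite leqNgt h add0n modn_small.
rewrite snocf_max (_ : ordS _ = ord0) ?consf0//.
by apply: val_inj; rewrite /= modnn.
Qed.

End TracePaths.

(** * Second moments of the trace and of its kernel *)

Section VarianceBounds.
Context {R : realType} {d} {T : measurableType d} (P : probability T R).
Variable (X : nat -> {RV P >-> R}).
Hypothesis hX : gaussian_input P X.
Local Notation env z := (fun i => X i z).
Local Notation "''E' f" := (Rintegral P setT f) (at level 10, f at level 8).

(** Expands squares of sums of words: each second moment below becomes arithmetic on Wick counts. *)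
Lemma expectation_comb (l : seq (R * seq (seq nat))) :
  'E (fun z => \sum_(a <- l) a.1 * weval (env z) a.2) =
  \sum_(a <- l) a.1 * (\sum_(w <- a.2) wick w)%N%:R.
Proof.
rewrite Rintegral_sum; last first.
  move=> a; rewrite (_ : EFin \o _ = (fun z => a.1%:E * (weval (env z) a.2)%:E)%E)//.
  by apply: integrableZl => //; exact: integrable_weval.
apply: eq_bigr => a _; rewrite RintegralZl//; last exact: integrable_weval.
by rewrite (expectation_weval hX) natr_sum.
Qed.

Definition square_words (B : nat) : seq (seq nat) := [seq [:: j; j] | j <- iota 0 B].

(** The first [j] pairs with the second or with an occurrence of [j] in [w], and [w] itself remains.
    Summed over [j], these choices number [B] plus the size of [w]. *)
Lemma sum_wick_square_words B w : all (fun l => l < B)%N w ->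
  (\sum_(v <- square_words B) wick (v ++ w) = (B + size w) * wick w)%N.
Proof.
move=> /allP wB; rewrite big_map /=.
under eq_bigr do rewrite wick_cons /= eqxx.
rewrite -big_distrl /= big_split /= sum1_size size_iota; congr ((_ + _) * _)%N.
elim: w wB => [|a w IH] wB; first by rewrite big1.
rewrite /= big_split /= IH; last by move=> x xw; apply: wB; rewrite inE xw orbT.
rewrite (_ : \sum_(i <- iota 0 B) (a == i) = 1)%N//.
have aB : (a < B)%N by apply: wB; rewrite mem_head.
rewrite (bigD1_seq a) ?iota_uniq ?mem_iota ?add0n ?aB//=.
by rewrite eqxx big1 ?addn0// => i; rewrite eq_sym => /negbTE ->.
Qed.

Section Words.
Variables (gs : seq (seq nat)) (p B : nat).
Hypothesis B0 : (0 < B)%N.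
Hypothesis szgs : forall w, w \in gs -> size w = p.
Hypothesis ltgs : forall w, w \in gs -> all (fun l => l < B)%N w.

Let S := (\sum_(w <- gs) wick w)%N.
Let m := 'E (fun z => weval (env z) gs).
Let V := 'E (fun z => (weval (env z) gs - m) ^+ 2).

Lemma meanE : m = S%:R.
Proof. by rewrite /m (expectation_weval hX) natr_sum. Qed.

Lemma sum_wick_squares_gs :
  (\sum_(w <- [seq v ++ w | v <- square_words B, w <- gs]) wick w = (B + p) * S)%N.
Proof.
rewrite big_allpairs_dep exchange_big /= /S big_distrr /= big_seq [RHS]big_seq.
by apply: eq_bigr => w wg; rewrite sum_wick_square_words ?szgs ?ltgs.
Qed.

Lemma sum_wick_squares : (\sum_(w <- square_words B) wick w = B)%N.
Proof.
have := @sum_wick_square_words B [::] isT.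
by under eq_bigr do rewrite cats0; rewrite addn0 muln1.
Qed.

Lemma sum_wick_squares2 :
  (\sum_(w <- [seq v ++ w | v <- square_words B, w <- square_words B]) wick w = (B + 2) * B)%N.
Proof.
rewrite big_allpairs_dep exchange_big /= -{4}sum_wick_squares big_distrr /= big_seq [RHS]big_seq.
apply: eq_bigr => _ /mapP[j jB ->]; rewrite sum_wick_square_words//=.
by move: jB; rewrite mem_iota /= => ->.
Qed.

Lemma varE : V = (\sum_(w <- [seq v ++ w | v <- gs, w <- gs]) wick w)%N%:R - S%:R ^+ 2.
Proof.
have := expectation_comb [:: (1, [seq v ++ w | v <- gs, w <- gs]); (- (2 * m), gs);
  (m ^+ 2, [:: [::]])].
rewrite !big_cons !big_nil /= !addr0 mul1r.
set Q := (_%:R in RHS) => h; rewrite -/Q.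
transitivity (Q + (- (2 * m) * S%:R + m ^+ 2 * 1)); last by rewrite meanE; ring.
rewrite -[in RHS](_ : (wick [::])%:R = 1)// -h.
apply: eq_Rintegral => z _.
rewrite !big_cons big_nil /= -weval_mul /weval big_seq1 mon_nil; ring.
Qed.

(* Cauchy-Schwarz between g and Q = sum_(j < B) X_j^2: homogeneity of g gives
   Cov(g, Q) = p E g, and Var Q = 2 B. *)
Lemma var_lower_bound : (p%:R * S%:R) ^+ 2 <= V * (2 * B%:R).
Proof.
have B1 : 0 < B%:R :> R by rewrite ltr0n.
(* The least squares coefficients: [t] = Cov(g, Q) / Var Q and [c] the matching intercept. The list
   [l] expands (g - tQ - c)^2, whose mean is nonnegative. *)
pose t : R := p%:R * S%:R / (2 * B%:R).
pose c : R := S%:R - t * B%:R.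
pose l := [:: (1, [seq v ++ w | v <- gs, w <- gs]);
  (- (2 * t), [seq v ++ w | v <- square_words B, w <- gs]);
  (t ^+ 2, [seq v ++ w | v <- square_words B, w <- square_words B]);
  (- (2 * c), gs); (2 * t * c, square_words B); (c ^+ 2, [:: [::]])].
have h := expectation_comb l.
have : 0 <= 'E (fun z => \sum_(a <- l) a.1 * weval (env z) a.2).
  apply: Rintegral_ge0 => z _.
  rewrite /l !big_cons big_nil /= -!weval_mul.
  rewrite (_ : weval (env z) [:: [::]] = 1); last by rewrite /weval big_seq1 mon_nil.
  rewrite [leRHS](_ : _ = (weval (env z) gs - t * weval (env z) (square_words B) - c) ^+ 2).
    exact: sqr_ge0.
  by ring.
rewrite h /l !big_cons !big_nil /= sum_wick_squares_gs sum_wick_squares sum_wick_squares2 addn0.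
rewrite -/S varE; set Q := (\sum_(_ <- _) _)%N%:R.
rewrite !natrM !natrD (_ : (wick [::])%:R = 1)// => h0.
rewrite -subr_ge0.
have := mulr_ge0 h0 (ltW (mulr_gt0 (ltr0Sn R 1) B1)).
congr (0 <= _); rewrite /c /t; field.
by rewrite gt_eqF.
Qed.

Lemma expectation_stein_kernel :
  'E (fun z => weval (env z) (stein_kernel gs)) = V.
Proof.
have := stein_identity hX gs lipschitz_deriv_id.
under [X in _ = X -> _]eq_Rintegral do rewrite mulr1.
move=> <-; rewrite -/m varE.
have := expectation_comb [:: (1, [seq v ++ w | v <- gs, w <- gs]); (- m, gs)].
rewrite !big_cons !big_nil /= !addr0 mul1r -/S.
have -> : S%:R ^+ 2 = m * S%:R by rewrite meanE expr2.
rewrite -mulNr => <-.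
apply: eq_Rintegral => z _.
by rewrite !big_cons big_nil /= -weval_mul; ring.
Qed.

(** As E Gamma = V, the left side equals (E Gamma^2 - V^2) / V^2, and [hC] bounds the numerator. *)
Lemma kernel_deviation (C : nat) : 0 < V ->
  (\sum_(t <- stein_kernel gs) \sum_(t' <- stein_kernel gs) wick (t ++ t') <=
    (\sum_(t <- stein_kernel gs) wick t) ^ 2 + C)%N ->
  'E (fun z => (1 - weval (env z) (stein_kernel gs) * V^-1) ^+ 2) <= C%:R / V ^+ 2.
Proof.
move=> V0 hC.
set K := stein_kernel gs in hC *.
have VE : V = (\sum_(t <- K) wick t)%N%:R.
  by rewrite -expectation_stein_kernel (expectation_weval hX) natr_sum.
have := expectation_comb [:: (V ^- 2, [seq v ++ w | v <- K, w <- K]); (- (2 / V), K); (1, [:: [::]])].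
rewrite !big_cons !big_nil /= !addr0 big_allpairs_dep -VE => h.
rewrite (_ : 'E _ = 'E (fun z => V ^- 2 * weval (env z) [seq v ++ w | v <- K, w <- K] +
    (- (2 / V) * weval (env z) K + (1 * weval (env z) [:: [::]] + 0)))); last first.
  apply: eq_Rintegral => z _; rewrite -weval_mul /weval big_seq1 mon_nil.
  by field; rewrite gt_eqF.
under eq_Rintegral do rewrite addr0.
rewrite (_ : 'E _ = V ^- 2 * (\sum_(t <- K) \sum_(t' <- K) wick (t ++ t'))%N%:R +
  (- (2 / V) * V + 1 * (wick [::])%:R)); last first.
  by rewrite -h; apply: eq_Rintegral => z _; rewrite !big_cons big_nil addr0.
move: hC; rewrite -(ler_nat R) natrD natrX -VE => hC.
have V2 : 0 < V ^+ 2 by rewrite exprn_gt0.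
rewrite ler_pdivlMr//.
rewrite [leLHS](_ : _ = (\sum_(t <- K) \sum_(t' <- K) wick (t ++ t'))%N%:R - V ^+ 2).
  by rewrite lerBlDl.
rewrite (_ : (wick [::])%:R = 1)//; field.
by rewrite gt_eqF.
Qed.

End Words.
End VarianceBounds.

(** * The two link functions *)

Section Links.
Variable n : nat.
Hypothesis n0 : (0 < n)%N.

Definition entry_link (L : nat -> nat -> nat -> nat) (a b : 'I_n) : nat := L n a.+1 b.+1.

Lemma rc_link_mod (a b : 'I_n) : entry_link rc_link a b = (a + b).+1 %[mod n].
Proof.
rewrite /entry_link /rc_link /residue1 addSn addnS subSS subn0.
by case: ifP => [|_]; [rewrite /dvdn => /eqP ->; rewrite modnn|rewrite modn_mod].
Qed.

Lemma link_sym L a b : L = rc_link \/ L = hankel_link ->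
  entry_link L a b = entry_link L b a.
Proof.
by case=> ->; rewrite /entry_link /rc_link /hankel_link addnC.
Qed.

Lemma link_inj L a : L = rc_link \/ L = hankel_link -> injective (entry_link L a).
Proof.
case=> -> b b' e; apply: ord_inj.
  have : (a + b).+1 = (a + b').+1 %[mod n] by rewrite -!rc_link_mod e.
  move/eqP; rewrite -!addSn eqn_modDl => /eqP.
  by rewrite !modn_small.
by move: e; rewrite /entry_link /hankel_link; lia.
Qed.

(** The common bound comes from the Hankel indices, which reach 2n - 1; reverse circulant indices
    stay at most n. *)
Lemma link_lt L a b : L = rc_link \/ L = hankel_link ->
  (entry_link L a b < 2 * n)%N.
Proof.
have := ltn_ord a; have := ltn_ord b => bn an.
case=> ->; rewrite /entry_link /rc_link /hankel_link /residue1; last by lia.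
case: ifP => _; first by lia.
by have := ltn_pmod (a.+1 + b.+1 - 1) n0; lia.
Qed.

End Links.

(** * Quantitative bound for the standardised trace *)

Section TraceTV.
Context {R : realType} {d : measure_display} {T : measurableType d} (P : probability T R).
Variable (X : nat -> {RV P >-> R}).
Hypothesis hX : gaussian_input P X.
Local Notation env z := (fun i => X i z).
Local Notation "''E' f" := (Rintegral P setT f) (at level 10, f at level 8).

Lemma trace_power_weval L n q z : trace_power L X n q.+2 z =
  weval (env z) (path_words q (@entry_link n L)).
Proof.
rewrite /trace_power tr_expmx_paths /weval sum_path_words; apply: eq_bigr => i _.
rewrite /mon /path_word big_map big_enum /=; apply: eq_bigr => k _.
by rewrite mxE.
Qed.

Lemma fine_expectation (Y : {RV P >-> R}) : fine 'E_P[Y] = 'E Y.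
Proof. by rewrite expectation_def. Qed.

Lemma fine_variance (Y : {RV P >-> R}) :
  fine 'V_P[Y] = 'E (fun z => (Y z - 'E Y) ^+ 2).
Proof.
rewrite /variance covariance.unlock expectation.unlock /Rintegral.
by congr fine.
Qed.

Lemma trace_tv_bound L n q (delta : R) : (0 < n)%N -> L = rc_link \/ L = hankel_link ->
  0 < delta ->
  ((4 * q.*2.+2) ^ (16 * q.*2.+2))%N%:R <= delta ^+ 2 * n%:R ->
  (tv_dist (distribution P (standardized P (trace_power L X n q.*2.+2)))
    (normal_prob (0 : R) (1 : R)) <= (2 * delta)%:E)%E.
Proof.
move=> n0 hL d0 hd.
set lam := @entry_link n L.
have lamC a b : lam a b = lam b a by exact: link_sym.
have lamI a : injective (lam a) by exact: link_inj.
have lamB a b : (lam a b < 2 * n)%N by exact: link_lt.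
set Y : {RV P >-> R} := trace_power L X n q.*2.+2.
set gs := path_words q.*2 lam.
have YE : (Y : T -> R) = (fun z => weval (env z) gs).
  by apply/funext => z; exact: trace_power_weval.
have szgs w : w \in gs -> size w = q.*2.+2.
  by case/mapP => i _ ->; exact: size_path_word.
have ltgs w : w \in gs -> all (fun l => l < 2 * n)%N w.
  by case/mapP => i _ ->; apply/allP => _ /mapP[k _ ->]; exact: lamB.
set m := 'E (fun z => weval (env z) gs).
set V := 'E (fun z => (weval (env z) gs - m) ^+ 2).
have nR : 0 < n%:R :> R by rewrite ltr0n.
have Vge : n%:R ^+ (q.*2 + 3) <= V.
  have B0 : (0 < 2 * n)%N by rewrite muln_gt0.
  have := var_lower_bound hX B0 szgs ltgs; rewrite -/m -/V.
  have := sum_wick_ge q lamC.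
  rewrite (_ : \sum_i _ = \sum_(w <- gs) wick w)%N; last by rewrite sum_path_words.
  set S := (\sum_(_ <- _) _)%N => hS hV.
  (* Of the length only the factor 2 is kept; squared, it cancels the constant of 2B = 4n and leaves
     V >= n^(P+1), where P = [q.*2.+2]. *)
  have h1 : (2 * n ^ q.+2 <= q.*2.+2 * S)%N by apply: leq_mul => //; lia.
  rewrite -(ler_nat R) natrM in h1.
  have h2 : (2 * (n ^ q.+2)%:R) ^+ 2 <= V * (2 * (2 * n)%:R) :> R.
    by apply: le_trans hV; rewrite lerXn2r ?nnegrE ?mulr_ge0// -[leRHS]natrM.
  move: h2; rewrite natrX exprMn -exprM natrM.
  rewrite (_ : q.+2 * 2 = (q.*2 + 3).+1)%N; last by lia.
  rewrite [n%:R ^+ _.+1]exprSr [X in _ <= X](_ : _ = 2 ^+ 2 * (V * n%:R)); last by ring.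
  by rewrite ler_pM2l ?exprn_gt0// ler_pM2r.
have V0 : 0 < V by apply: lt_le_trans Vge; rewrite exprn_gt0.
have kc := @kernel_covariance n q.*2 lam.
rewrite -/gs in kc.
have kd := kernel_deviation hX V0 kc.
rewrite -/m -/V in kd.
set C := (_ * #|_|)%N in kc kd.
(* With P = [q.*2.+2] the last exponent is 2P + 1, one less than that of n in the lower bound for
   V^2; this is the gain of 1/n. *)
have hC : (C <= (4 * q.*2.+2) ^ (16 * q.*2.+2) * n ^ (q.*2.*2 + 5))%N.
  rewrite /C; apply: leq_trans (leq_mul (leqnn _) (card_is_linked q.*2 lamC lamI lamB)) _.
  apply: leq_trans (leq_mul (kernel_constant_le q) (leqnn _)).
  rewrite [((2 * n) ^ _)%N]expnMn; set a := (q.*2.*2.+1 ^ _)%N; set b := (2 ^ q.*2.*2.+1)%N.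
  rewrite (_ : q.*2.*2 + 5 = 4 + q.*2.*2.+1)%N; last by lia.
  by rewrite expnD; apply/eq_leq; ring.
have hdev : 'E (fun z => (1 - weval (env z) (stein_kernel gs) * V^-1) ^+ 2) <= delta ^+ 2.
  apply: (le_trans kd); rewrite ler_pdivrMr ?exprn_gt0//.
  rewrite -(ler_nat R) natrM in hC; apply: (le_trans hC).
  rewrite [(n ^ _)%N%:R]natrX; apply: (@le_trans _ _ (delta ^+ 2 * n%:R * n%:R ^+ (q.*2.*2 + 5))).
    by rewrite ler_wpM2r// exprn_ge0.
  rewrite -mulrA ler_wpM2l ?sqr_ge0// -exprS.
  rewrite (_ : (q.*2.*2 + 5).+1 = (q.*2 + 3) * 2)%N; last by lia.
  by rewrite exprM lerXn2r ?nnegrE// ?exprn_ge0// ltW.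
have sV : Num.sqrt V ^+ 2 = V by rewrite sqr_sqrtr// ltW.
rewrite -sV in hdev.
have WE z : standardized P Y z = (weval (env z) gs - m) / Num.sqrt V.
  by rewrite /standardized fine_expectation fine_variance YE.
have tv := stein_tv hX (erefl m) (_ : 0 < Num.sqrt V) d0 WE hdev.
rewrite /tv_dist; apply: ge_ereal_sup => _ [B mB <-].
by apply: tv => //; rewrite sqrtr_gt0.
Qed.

End TraceTV.

(** As ln ln x >= 1, the hypothesis on m first gives 4m <= ln x, so ln(4m) <= ln ln x; it then
    bounds 32 m ln(4m) by ln x. *)
Lemma power_bound {R : realType} (m : nat) (x : R) : (0 < m)%N -> 1 <= ln (ln x) ->
  0 < x -> m%:R * ln (ln x) <= 32^-1 * ln x ->
  ((4 * m) ^ (32 * m))%N%:R <= x.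
Proof.
move=> m0 lx x0 hm.
have m1 : 0 < m%:R :> R by rewrite ltr0n.
have lnx0 : 0 < ln x.
  by have : 0 < m%:R * ln (ln x) by [rewrite mulr_gt0//; lra]; lra.
have h4 : (4 * m)%N%:R <= ln x.
  have : m%:R <= m%:R * ln (ln x) by rewrite ler_peMr// ltW.
  rewrite natrM; lra.
have p4 : 0 < (4 * m)%N%:R :> R by rewrite ltr0n muln_gt0.
have l4 : ln (4 * m)%N%:R <= ln (ln x) by rewrite ler_ln.
rewrite natrX -ler_ln ?posrE ?exprn_gt0// lnXn// -[leLHS]mulr_natl.
apply: (@le_trans _ _ ((32 * m)%N%:R * ln (ln x))); first by rewrite ler_wpM2l.
rewrite natrM -mulrA; lra.
Qed.

Theorem theorem3 (R : realType) (d : measure_display) (T : measurableType d)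
    (P : probability T R) (X : nat -> {RV P >-> R})
    (L : nat -> nat -> nat -> nat) (p : nat -> nat)
    (hX : gaussian_input P X)
    (hL : L = rc_link \/ L = hankel_link)
    (hp : forall n : nat, (0 < n)%N -> (0 < p n)%N /\ ~~ odd (p n))
    (hpo : (fun n : nat => (p n)%:R : R) =o_\oo
           (fun n : nat => ln n%:R / ln (ln n%:R) : R)) :
  tv_dist (distribution P (standardized P (trace_power L X n (p n))))
          (normal_prob (0 : R) (1 : R)) @[n --> \oo] --> 0%E.
Proof.
set tv := fun n => tv_dist _ _.
have tv0 n : (0 <= tv n)%E.
  apply: le_trans (ereal_sup_ubound _); last by exists set0; [exact: measurable0|].
  exact: abse_ge0.
have tvle (e : R) : 0 < e -> \forall n \near \oo, (tv n <= e%:E)%E.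
  move=> e0.
  (* 32 is twice the exponent 16 of the kernel constant (4p)^(16p), so that the square of this
     constant is at most n. *)
  have e32 : 0 < 32^-1 :> R by rewrite invr_gt0.
  have := (eqoP _ _ _).1 hpo _ e32; rewrite near_simpl => ho.
  near=> n.
  have hn : expR (expR 1) <= n%:R :> R by near: n; exact: nbhs_infty_ger.
  (* With delta = e / 2 this says 1 <= delta^4 n, which upgrades a^2 <= n to a^2 <= (delta^2 n)^2,
     where a is the kernel constant. *)
  have he : ((e / 2) ^+ 4)^-1 <= n%:R :> R by near: n; exact: nbhs_infty_ger.
  have hpn : `|(p n)%:R| <= 32^-1 * `|ln n%:R / ln (ln n%:R)| :> R by near: n.
  have nR : 0 < n%:R :> R by apply: lt_le_trans hn; exact: expR_gt0.
  have n0 : (0 < n)%N by rewrite -(ltr0n R).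
  have [pn0 pne] := hp n n0.
  have [q pq] : exists q, p n = q.*2.+2.
    exists (p n)./2.-1; have := odd_double_half (p n); rewrite (negbTE pne); lia.
  have l1 : expR 1 <= ln n%:R :> R by rewrite -(expRK (expR 1)) ler_ln ?posrE ?expR_gt0.
  have l2 : 1 <= ln (ln n%:R) :> R.
    rewrite -[leLHS]expRK ler_ln ?posrE ?expR_gt0//.
    by apply: lt_le_trans l1; exact: expR_gt0.
  have ln0 : 0 < ln n%:R :> R by apply: lt_le_trans l1; exact: expR_gt0.
  have lln0 : 0 < ln (ln n%:R) :> R by apply: lt_le_trans l2; exact: ltr01.
  have hpn' : (p n)%:R * ln (ln n%:R) <= 32^-1 * ln n%:R :> R.
    move: hpn; rewrite normr_nat gtr0_norm ?divr_gt0// mulrA ler_pdivlMr//.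
  have pb := power_bound pn0 l2 nR hpn'.
  rewrite /tv pq (_ : e = 2 * (e / 2)); last by field.
  apply: trace_tv_bound => //; first by rewrite divr_gt0.
  have e16 : (16 * p n * 2 = 32 * p n)%N by rewrite mulnAC.
  rewrite -pq; set a := ((4 * p n) ^ (16 * p n))%N%:R.
  have a0 : 0 <= a :> R by rewrite ler0n.
  have ha : a ^+ 2 <= n%:R :> R.
    by rewrite /a -natrX -expnM e16.
  have d0 : 0 < e / 2 by rewrite divr_gt0.
  rewrite -(@ler_pXn2r _ 2)// ?nnegrE//; last by rewrite mulr_ge0 ?sqr_ge0// ltW.
  apply: (le_trans ha); rewrite exprMn -exprM [n%:R ^+ 2]expr2 mulrA ler_peMl//.
  by rewrite mulrC -ler_pdivrMr ?exprn_gt0// mul1r.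
apply/fine_cvgP; split.
  have := tvle 1 ltr01; apply: filterS => n h.
  by rewrite ge0_fin_numE// (le_lt_trans h)// ltry.
apply/cvgrPdist_le => e e0.
have := tvle e e0; apply: filterS => n h.
rewrite sub0r normrN /= ger0_norm ?fine_ge0//.
by rewrite -lee_fin fineK// ge0_fin_numE// (le_lt_trans h)// ltry.
Unshelve. all: by end_near. Qed.
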